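(* Let $U=[0,1]^2$ be the unit square and let $U_3=[-\tfrac12,\tfrac32]^2$ be the square of side length $2$ that is concentric and homothetic to $U$. If $\Gamma$ is a (rectifiable) barrier for $U$ with $\Gamma\subseteq U_3$, then the length of $\Gamma$ is at least $2+10^{-12}$.
   Context: A set $\Gamma\subset\mathbb{R}^2$ is a barrier (opaque set) for a convex body $C$ in the plane if $\Gamma$ meets every line that intersects $C$. A barrier need not be connected. Barriers are assumed rectifiable: $\Gamma$ is a countable (finite or infinite) union $\Gamma=\bigcup_i\gamma_i$ of rectifiable curves (curves of finite length) with $\sum_i|\gamma_i|<\infty$, where $|\gamma_i|$ is the length of $\gamma_i$; the length of $\Gamma$ is the total length $\sum_i|\gamma_i|$ of its curves. *)

(* Defs.v *)
From HB Require Import structures.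
From mathcomp Require Import all_boot all_order all_algebra.
From mathcomp Require Import all_classical all_reals all_analysis.
Set Implicit Arguments.
Unset Strict Implicit.
Unset Printing Implicit Defensive.
Import Order.TTheory GRing.Theory Num.Theory.
Import numFieldNormedType.Exports.
Local Open Scope classical_set_scope.
Local Open Scope ring_scope.

(* The library norm on [R * R] is the sup norm; lengths must be Euclidean. *)
Definition edist (R : realType) (p q : R * R) : R :=
  Num.sqrt ((p.1 - q.1) ^+ 2 + (p.2 - q.2) ^+ 2).

(* The values of [curve_fun] outside [curve_lo, curve_hi] are irrelevant: only
   the restriction to that interval matters for continuity, image and length. *)
Record curve (R : realType) := Curve {
  curve_lo : R;
  curve_hi : R;
  curve_fun :> R -> R * R;
  curve_le : curve_lo <= curve_hi;
  curve_continuous : {within `[curve_lo, curve_hi], continuous curve_fun}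
}.

Definition curve_image (R : realType) (g : curve R) : set (R * R) :=
  g @` `[curve_lo g, curve_hi g].

(* As for [variation], [s] lists the points of the subdivision after [a]. *)
Definition polygonal_length (R : realType) (a : R) (f : R -> R * R)
    (s : seq R) : R :=
  \sum_(0 <= k < size s) edist (f (nth a (a :: s) k.+1)) (f (nth a (a :: s) k)).

Definition curve_length (R : realType) (g : curve R) : \bar R :=
  ereal_sup [set (polygonal_length (curve_lo g) g s)%:E
            | s in itv_partition (curve_lo g) (curve_hi g)].

Definition total_length (R : realType) (I : countType) (g : I -> curve R) :
    \bar R :=
  \esum_(i in [set: I]) curve_length (g i).

Definition rectifiable_union (R : realType) (I : countType)
    (g : I -> curve R) (Gamma : set (R * R)) : Prop :=
  [/\ Gamma = \bigcup_(i in [set: I]) curve_image (g i),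
      forall i, (curve_length (g i) < +oo)%E
    & (total_length g < +oo)%E].

Definition is_line (R : realType) (L : set (R * R)) : Prop :=
  exists a b c : R, (a != 0) || (b != 0) /\
    L = [set p | a * p.1 + b * p.2 = c].

Definition barrier (R : realType) (C Gamma : set (R * R)) : Prop :=
  forall L : set (R * R), is_line L -> L `&` C !=set0 -> L `&` Gamma !=set0.

Definition square (R : realType) (a b : R) : set (R * R) :=
  `[a, b]%classic `*` `[a, b]%classic.

(* Main.v *)
(* In the directions (1,1) and (1,-1) the projections of a segment (dx,dy) have
   total length 2 max(|dx|,|dy|), and those of the unit square have total length
   4.  Hence a barrier has length at least 2, and one of length 2 + eps consists,
   up to a small part, of nearly horizontal pieces H and nearly vertical pieces V,
   each of total length about 1.  Moreover, in every direction (1-l,+-l) with l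
   away from 0 and 1 its total projected length exceeds that of the square by
   O(eps) only: the measure of the lines that meet it more than once, counted
   with excess multiplicity ("waste"), is O(eps).

   On the other hand the x-projection of H and the y-projection of V cover an
   interval of length 1 with little overlap, so for a positive proportion of the
   pairs (p,q) in H x V the line pq is neither nearly horizontal nor nearly
   vertical, and it meets the barrier twice.  These pairs cannot be concentrated
   on few lines.  In the plane of lines (l,t) a small piece is a thin strip.
   Around the crossing point of two strips take the largest scale r at which the
   window of width r contains far more than r worth of pieces (or the scale of a
   single piece if there is none).  As strips have bounded slope, the excess
   persists for a time of order r, which costs waste of order r^2, while
   maximality of r bounds the number of crossings nearby by the order of r^2.
   A greedy selection of disjoint boxes bounds the number of all crossings by a
   constant times the waste, a contradiction when eps is small. *)

Require Import Defs.
From HB Require Import structures.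
From mathcomp Require Import all_boot all_order all_algebra.
From mathcomp Require Import reals ring lra.
From mathcomp Require all_classical all_reals all_analysis measurable_realfun.
Import Order.TTheory GRing.Theory Num.Theory.
Local Open Scope ring_scope.

Set Implicit Arguments.
Unset Strict Implicit.

(** * Lebesgue measure *)

(* A section keeps these imports local: they shadow names of finset used below. *)
Section LebesguePacking.
Import all_classical all_reals all_analysis measurable_realfun.
Import numFieldNormedType.Exports.
Local Open Scope classical_set_scope.

(** Integrate [pack] over [U]: the weighted sum of indicators stays below the constant [W]. *)
Lemma measure_packing (d : measure_display) (T : measurableType d) (R : realType)
    (mu : {measure set T -> \bar R}) (J : finType) (D : {set J}) (U : set T)
    (I : J -> set T) (w : J -> R) (W : R) :
    measurable U -> (forall b, measurable (I b)) ->
    (forall b, b \in D -> 0 <= w b /\ I b `<=` U) ->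
    (forall x, U x -> \sum_(b in D | x \in I b) w b <= W) ->
  (\sum_(b in D) (w b)%:E * mu (I b) <= W%:E * mu U)%E.
Proof.
move=> mU mI wI pack.
pose f b (x : T) : \bar R := ((`|w b|)%:E * (\1_(I b) x)%:E)%E.
have mf b : measurable_fun U (f b).
  by apply: measurable_funeM; apply/measurable_EFinP; exact: measurable_indic.
have f0 b x : U x -> (0 <= f b x)%E by move=> _; rewrite mule_ge0 // lee_fin.
have intf b : b \in D -> (\int[mu]_(x in U) f b x = (w b)%:E * mu (I b))%E.
  move=> bD; have [wb IU] := wI b bD.
  rewrite ge0_integralZl_EFin //; last first.
    by apply/measurable_EFinP; exact: measurable_indic.
  by rewrite integral_indic // setIidl // ger0_norm.
rewrite -(eq_bigr _ intf) -big_enum /= -ge0_integral_sum // -(integral_cst mu mU).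
apply: ge0_le_integral => //.
- by move=> x Ux; apply: sume_ge0 => b _; exact: f0.
- by apply: emeasurable_sum => b; exact: mf.
- move=> x Ux; rewrite big_enum /=.
  have := pack x Ux; rewrite -lee_fin; apply: le_trans.
  rewrite big_mkcondr -sumEFin; apply: lee_sum => b bD.
  have [wb _] := wI b bD.
  rewrite /f ger0_norm // indicE; case: (x \in I b); first by rewrite mule1.
  by rewrite mule0.
Qed.

Lemma lebesgue_closed_ball_itv (R : realType) (c d : R) : 0 <= d ->
  lebesgue_measure `[c - d, c + d] = (d *+ 2)%:E.
Proof.
move=> d0; rewrite lebesgue_measure_itv /= lte_fin -EFinD.
by case: ltP => h; congr (_%:E); move: h d0; clear; lra.
Qed.

Lemma interval_packing (R : realType) (T : finType) (D : {set T})
    (c d w : T -> R) (W : R) :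
    (forall b, b \in D -> [/\ 0 <= w b, 0 <= d b, 0 <= c b - d b & c b + d b <= 1]) ->
    (forall x : R, 0 <= x <= 1 -> \sum_(b in D | `|x - c b| <= d b) w b <= W) ->
  \sum_(b in D) w b * (d b *+ 2) <= W.
Proof.
move=> bnd pack.
have mu01 : lebesgue_measure `[(0 : R), 1] = 1%E.
  by rewrite lebesgue_measure_itv /= lte01 sube0.
pose A b : set R := `[c b - d b, c b + d b]%classic.
rewrite -lee_fin -sumEFin -[leRHS]mule1 -mu01.
rewrite (eq_bigr (fun b => (w b)%:E * lebesgue_measure (A b))%E).
  apply: measure_packing => [||b bD|x].
  - exact: measurable_itv.
  - by move=> b; exact: measurable_itv.
  - have [wb db l u] := bnd b bD; split=> //.
    suff sub (x : R) : A b x -> `[0, 1]%classic x by exact: sub.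
    rewrite /A /= !in_itv /= => /andP[x1 x2].
    by rewrite (le_trans l x1) (le_trans x2 u).
  - suff sub (y : R) : `[0, 1]%classic y -> \sum_(b in D | y \in A b) w b <= W by exact: sub.
    rewrite /= in_itv /= => y01; apply: le_trans (pack y y01).
    rewrite le_eqVlt; apply/orP; left; apply/eqP; apply: eq_bigl => b.
    by congr (_ && _); rewrite ler_distl; apply/idP/idP; rewrite inE /A /= in_itv.
by move=> b bD; have [_ db _ _] := bnd b bD; rewrite /A lebesgue_closed_ball_itv // EFinM.
Qed.

Lemma interval_cover_length (R : realType) (I : countType) (c r : I -> R) (a b S : R) :
    (forall i, 0 <= r i) ->
    (forall t, a <= t <= b -> exists i, `|t - c i| <= r i) ->
    (forall s : seq I, uniq s -> \sum_(i <- s) r i *+ 2 <= S) ->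
  b - a <= S.
Proof.
move=> r0 cov bound.
have [ab|ba] := leP a b; last first.
  have : 0 <= S by have := bound [::] isT; rewrite big_nil.
  by move: ba; clear; lra.
(* [pickle_inv] lists [I] along the naturals; a number that codes no index gives the empty set, so
   sigma-subadditivity applies. *)
pose A (n : nat) : set R :=
  if @pickle_inv I n is Some i then `[c i - r i, c i + r i]%classic else set0.
pose mu := @lebesgue_measure R.
have mA n : measurable (A n) by rewrite /A; case: pickle_inv => // i; exact: measurable_itv.
have sub : `[a, b]%classic `<=` \bigcup_n A n.
  move=> t; rewrite /= in_itv /= => /cov[i ti]; exists (pickle i) => //.
  by rewrite /A pickleK_inv /= in_itv /= -ler_distl.
have muab : mu `[a, b]%classic = (b - a)%:E.
  rewrite /mu lebesgue_measure_itv /= lte_fin -EFinD; case: ltP => // ba.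
  by congr (_%:E); move: ab ba; clear; lra.
have le1 : ((b - a)%:E <= \sum_(0 <= n <oo) mu (A n))%E.
  by rewrite -muab; exact: measure_sigma_subadditive.
rewrite -lee_fin; apply: le_trans le1 _.
apply: lime_le; first by apply: is_cvg_nneseries => n _ _; exact: measure_ge0.
near=> n.
have -> : (\sum_(0 <= i < n) mu (A i) =
   (\sum_(i <- pmap (@pickle_inv I) (iota 0 n)) r i *+ 2)%:E)%E.
  rewrite /index_iota subn0 -sumEFin.
  elim: (iota 0 n) => [|m s IH]; first by rewrite !big_nil.
  rewrite big_cons IH /= /A; case: pickle_inv => [i|] /=; last first.
    by rewrite [mu _](measure0 (@lebesgue_measure R)) add0e.
  by rewrite big_cons /mu lebesgue_closed_ball_itv.
rewrite lee_fin; apply: bound; apply: (pmap_uniq (@pickle_invK I)); exact: iota_uniq.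
Unshelve. all: by end_near.
Qed.

End LebesguePacking.

(** * Crossings and waste *)

(** A Vitali selection: keep an element of largest [nu], discard everything related to it, which it
    dominates, and repeat. *)
Lemma greedy_selection (T : finType) (rel : rel T) (nu : T -> nat) (A : {set T}) :
    reflexive rel ->
  exists D : {set T}, [/\ D \subset A,
    {in D &, forall i j, rel i j -> i = j} &
    forall i, i \in A -> exists2 j, j \in D & (rel i j || rel j i) && (nu i <= nu j)%N].
Proof.
move=> relxx; have [n] := ubnP #|A|; elim: n A => // n IHn A ltAn.
have [->|[a0 Aa0]] := set_0Vmem A.
  by exists set0; split=> [||i]; rewrite ?sub0set ?inE // => i j; rewrite inE.
pose m := [arg max_(i > a0 in A) nu i]%N.
have [mA mmax] : m \in A /\ forall i, i \in A -> (nu i <= nu m)%N.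
  by rewrite /m; case: arg_maxnP => [|i iA imax] //; split=> // j /imax.
pose A' := [set i in A | ~~ (rel i m || rel m i)].
have [|D [sDA' Dind Ddom]] := IHn A'.
  rewrite -ltnS; apply: leq_trans ltAn; rewrite ltnS; apply: proper_card.
  apply/properP; split; first by apply/subsetP => i; rewrite inE => /andP[].
  by exists m => //; rewrite inE mA relxx.
exists (m |: D); split.
- rewrite subUset sub1set mA /=; apply: subset_trans sDA' _.
  by apply/subsetP => i; rewrite inE => /andP[].
- have notrel j : j \in D -> ~~ (rel j m || rel m j).
    by move/(subsetP sDA'); rewrite inE => /andP[].
  move=> i j /setU1P[->|iD] /setU1P[->|jD] //; last exact: Dind.
    by move=> r; have := notrel _ jD; rewrite r orbT.
  by move=> r; have := notrel _ iD; rewrite r.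
- move=> i iA; have [r|nr] := boolP (rel i m || rel m i).
    by exists m; rewrite ?setU11 // r mmax.
  have [|j jD jr] := Ddom i; first by rewrite inE iA.
  by exists j => //; rewrite setU1r.
Qed.

(** The set of [n] with [n <= f n] is bounded by [N]; adding [n0] makes it nonempty, and [nu] is its
    maximum. *)
Lemma maximal_scale (n0 N : nat) (f : nat -> nat) : (forall n, f n <= N)%N ->
  exists nu, [/\ (n0 <= nu)%N, nu = n0 \/ (nu <= f nu)%N &
    forall n, (nu < n)%N -> (f n < n)%N].
Proof.
move=> fN; pose P n := (n == n0) || (n <= f n)%N.
have exP : exists n, P n by exists n0; rewrite /P eqxx.
have ubP n : P n -> (n <= maxn n0 N)%N.
  case/orP => [/eqP->|nf]; first exact: leq_maxl.
  by rewrite leq_max (leq_trans nf (fN n)) orbT.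
case: (ex_maxnP exP ubP) => nu Pnu numax; exists nu; split.
- by apply: numax; rewrite /P eqxx.
- by case/orP: Pnu => [/eqP|]; [left|right].
- move=> n; apply: contraTT; rewrite -!leqNgt => nfn.
  by apply: numax; rewrite /P nfn orbT.
Qed.

Lemma card_le_cover (T J : finType) (Q : {set T}) (D : {set J}) (X : J -> {set T}) :
  (forall p, p \in Q -> exists2 b, b \in D & p \in X b) ->
  (#|Q| <= \sum_(b in D) #|X b|)%N.
Proof.
move=> cov; rewrite -sum1_card.
have -> : (\sum_(b in D) #|X b| = \sum_p \sum_(b in D) (p \in X b))%N.
  rewrite exchange_big /=; apply: eq_bigr => b _.
  by rewrite -sum1_card big_mkcond /=; apply: eq_bigr => p _; case: (p \in X b).
rewrite big_mkcond /=; apply: leq_sum => p _.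
case: ifP => // /cov[b bD pX].
by rewrite (bigD1 b) //= pX.
Qed.

(* The line (1-l) X + l Y = t is the point (l,t); as l varies, the lines through
   the centre (x,y) of a piece trace the graph of t = shadow x y l. *)
Definition shadow (R : pzRingType) (K : Type) (x y : K -> R) (l : R) (k : K) : R :=
  (1 - l) * x k + l * y k.

Lemma shadow_speed (R : realFieldType) (K : Type) (x y : K -> R) (l l' : R) (k : K) :
  `|x k| <= 1 -> `|y k| <= 1 ->
  `|shadow x y l k - shadow x y l' k| <= 2 * `|l - l'|.
Proof.
move=> hx hy.
have -> : shadow x y l k - shadow x y l' k = (y k - x k) * (l - l').
  by rewrite /shadow; ring.
rewrite normrM ler_wpM2r //.
by apply: (le_trans (ler_normB _ _)); lra.
Qed.

(* [h l k] is half the length of the projection of piece [k], and [w] bounds the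
   waste in each direction; the crossing of the pair [p] is at [l = lam p]. *)
Lemma few_crossings (R : realType) (K : finType) (S : {set K})
    (x y : K -> R) (h : R -> K -> R) (eta w : R) (Q : {set K * K}) (lam : K * K -> R) :
    0 < eta -> eta <= 1 / 1000 -> #|S|%:R * eta <= 21 / 10 ->
    (forall k, k \in S -> `|x k| <= 1 /\ `|y k| <= 1) ->
    (forall l k, 2 / 25 <= l <= 23 / 25 -> k \in S ->
       38 / 1000 * eta <= h l k <= eta / 2) ->
    (forall l, 2 / 25 <= l <= 23 / 25 ->
       forall (D : {set K * K}) (B : K * K -> {set K}) (c r : K * K -> R),
       (forall b b' k, b \in D -> b' \in D -> k \in B b -> k \in B b' -> b = b') ->
       (forall b, b \in D -> 0 <= r b) ->
       (forall b k, b \in D -> k \in B b -> `|shadow x y l k - c b| + h l k <= r b) ->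
       \sum_(b in D) (\sum_(k in B b) h l k *+ 2 - r b *+ 2) <= w) ->
    (forall p, p \in Q -> [/\ p.1 \in S, p.2 \in S, p.1 != p.2, 1 / 11 <= lam p <= 10 / 11 &
       shadow x y (lam p) p.1 = shadow x y (lam p) p.2]) ->
  #|Q|%:R * eta ^+ 2 <= 25 * 10 ^+ 9 / 56 * w.
Proof.
move=> eta0 eta1 Seta xyS hS waste crossing.
pose z p := shadow x y (lam p) p.1.
pose win (p : K * K) (n : nat) : {set K} :=
  [set k in S | `|shadow x y (lam p) k - z p| <= n%:R * eta / 100].
(* Scales are counted in units of [eta / 100], so the floor [100] is a window of half-width [eta],
   the size of a single piece. *)
have /fin_all_exists[nu nuP] : forall p, exists n : nat, [/\ (100 <= n)%N,
    n = 100%N \/ (n <= #|win p n|)%N & forall m, (n < m)%N -> (#|win p m| < m)%N].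
  move=> p; apply: (@maximal_scale _ #|S|) => m.
  by apply: subset_leq_card; apply/subsetP => k; rewrite inE => /andP[].
(* The scale at the crossing p is r = nu p * eta / 100. *)
pose rel : rel (K * K) := fun p q =>
  (`|lam p - lam q| <= (nu p + nu q)%:R * eta / 400) &&
  (`|z p - z q| <= (nu p + nu q)%:R * eta / 50).
have relxx : reflexive rel.
  by move=> p; rewrite /rel !subrr normr0 !divr_ge0 ?mulr_ge0 ?ler0n ?(ltW eta0).
have relC : symmetric rel.
  by move=> p q; rewrite /rel addnC (distrC (lam p)) (distrC (z p)).
have [D [DQ Dind Ddom]] := greedy_selection nu Q relxx.
pose pile p := (nu p <= #|win p (nu p)|)%N.
pose del p : R := if pile p then (nu p)%:R * eta / 400 else eta / 200.
(* In a pile, [nu p] pieces of projected length at least [76/1000 * eta] lie in an interval of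
   length [nu p * eta / 25], an excess of [36/1000 * nu p * eta]. Otherwise the two crossing pieces
   overlap: the shorter one, less the drift [eta / 50], leaves [56/1000 * eta]. *)
pose wt p : R := if pile p then 36 / 1000 * ((nu p)%:R * eta) else 56 / 1000 * eta.
pose B p : {set K} := if pile p then win p (nu p) else [set p.1; p.2].
pose r l p : R := if pile p then (nu p)%:R * eta / 50
  else eta / 100 + Num.max (h l p.1) (h l p.2).
have nu100 p : (100 : R) <= (nu p)%:R by rewrite ler_nat; case: (nuP p).
have nueta p : 100 * eta <= (nu p)%:R * eta by rewrite ler_wpM2r // ltW.
have delnu p : 0 < del p <= (nu p)%:R * eta / 400.
  by rewrite /del; case: ifP => _; have := nueta p; lra.
(* A pile has at most [#|S|] pieces, so its duration is bounded through [Seta]. This keeps times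
   near [lam p], which is in [[1/11, 10/11]], inside [[2/25, 23/25]]. *)
have del_small p : del p <= 21 / 4000.
  rewrite /del; case: ifP => [pl|_]; last by move: eta1; clear; lra.
  suff : (nu p)%:R * eta <= #|S|%:R * eta by move: Seta; clear; lra.
  rewrite ler_wpM2r ?(ltW eta0) // ler_nat; apply: leq_trans pl _.
  by apply: subset_leq_card; apply/subsetP => k; rewrite inE => /andP[].
have crossD b : b \in D -> [/\ b.1 \in S, b.2 \in S, b.1 != b.2, 1 / 11 <= lam b <= 10 / 11 &
       shadow x y (lam b) b.1 = shadow x y (lam b) b.2].
  by move=> /(subsetP DQ); exact: crossing.
have BS b k : b \in D -> k \in B b -> k \in S.
  move=> bD; rewrite /B; case: ifP => _; first by rewrite inE => /andP[].
  by case/crossD: bD => ? ? _ _ _ /set2P[]->.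
have near b k l : b \in D -> k \in B b -> `|l - lam b| <= del b ->
    `|shadow x y l k - z b| + (if pile b then eta / 2 else 0) <=
    (if pile b then (nu b)%:R * eta / 50 else eta / 100).
  move=> bD kB lb; have [xk yk] := xyS k (BS _ _ bD kB).
  have sp := shadow_speed l (lam b) xk yk.
  have tri := ler_distD (shadow x y (lam b) k) (shadow x y l k) (z b).
  move: kB lb; rewrite /B /del; have := nueta b; case: ifP => _ en.
    by rewrite inE => /andP[kS]; move: sp tri en; clear; lra.
  case: (crossD _ bD) => _ _ _ _ eqs kB lb.
  suff zk : shadow x y (lam b) k = z b by move: sp lb en; rewrite zk; clear; lra.
  by case/set2P: kB => ->; rewrite /z // eqs.
(* A piece shared at a common time [l] brings the two crossings within the thresholds of [rel],
   which selected crossings satisfy only if equal. *)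
have Bdisj l b b' k : b \in D -> b' \in D -> `|l - lam b| <= del b ->
    `|l - lam b'| <= del b' -> k \in B b -> k \in B b' -> b = b'.
  move=> bD b'D lb lb' kB kB'; apply: Dind => //.
  have near' a : a \in D -> k \in B a -> `|l - lam a| <= del a ->
      `|shadow x y l k - z a| <= (nu a)%:R * eta / 50.
    move=> aD ka la; have := near _ _ _ aD ka la; have := nueta a.
    by move: eta0; clear; case: ifP => _; lra.
  have n1 := near' _ bD kB lb; have n2 := near' _ b'D kB' lb'.
  rewrite /rel natrD; apply/andP; split.
    have := ler_distD l (lam b) (lam b'); rewrite (distrC (lam b) l).
    have /andP[_] := delnu b; have /andP[_] := delnu b'.
    by move: lb lb'; clear; lra.
  have := ler_distD (shadow x y l k) (z b) (z b'); rewrite (distrC (z b) (shadow x y l k)).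
  by move: n1 n2; clear; lra.
have lrange b l : b \in D -> `|l - lam b| <= del b -> 2 / 25 <= l <= 23 / 25.
  case/crossD => _ _ _ lb _; rewrite ler_norml => /andP[l1 l2].
  by have := del_small b; move: lb l1 l2; clear; lra.
(* Within del b of lam b, the pieces of B b lie in an interval shorter by wt b
   than their total length, and the families B b in force are disjoint. *)
have packed : \sum_(b in D) wt b * (del b *+ 2) <= w.
  have w0 : 0 <= w.
    have := waste (1 / 2) _ set0 (fun=> set0) (fun=> 0) (fun=> 0).
    rewrite big_set0; apply => [|b b' k||b k]; rewrite ?inE //; lra.
  apply: (@interval_packing R _ _ lam) => [b bD|l l01].
    have /andP[d0 _] := delnu b; have ds := del_small b; have n1 := nueta b.
    have [_ _ _ lb _] := crossD _ bD.
    move: eta0 d0 ds n1 lb; rewrite /wt; clear => *.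
    by split; [case: ifP => _|..]; lra.
  pose D' := [set b in D | `|l - lam b| <= del b].
  rewrite (eq_bigl (mem D')); last by move=> b; rewrite !inE.
  have [->|[b0]] := set_0Vmem D'; first by rewrite big_set0.
  rewrite inE => /andP[b0D b0l].
  have lr := lrange _ _ b0D b0l.
  have D'P b : b \in D' -> b \in D /\ `|l - lam b| <= del b.
    by rewrite inE => /andP.
  apply: le_trans (waste l lr D' B z (r l) _ _ _); last 3 first.
  - by move=> b b' k /D'P[bD lb] /D'P[b'D lb']; exact: Bdisj lb lb'.
  - move=> b /D'P[bD lb]; rewrite /r; have := nueta b; case: ifP => _ n1.
      by move: eta0 n1; clear; lra.
    case: (crossD _ bD) => b1 _ _ _ _; have /andP[h1 _] := hS l _ lr b1.
    have : h l b.1 <= Num.max (h l b.1) (h l b.2) by rewrite le_max lexx.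
    by move: eta0 h1; clear; lra.
  - move=> b k /D'P[bD lb] kB; have n0 := near _ _ _ bD kB lb; have kS := BS _ _ bD kB.
     have /andP[_ hk] := hS l _ lr kS.
    move: kB n0; rewrite /r /B; case: ifP => _ kB n0; first by move: hk n0; clear; lra.
    suff : h l k <= Num.max (h l b.1) (h l b.2) by move: n0; clear; lra.
    by case/set2P: kB => ->; rewrite le_max lexx ?orbT.
  apply: ler_sum => b /D'P[bD lb]; have n1 := nueta b.
  have [b1S b2S b12 _ _] := crossD _ bD.
  rewrite /wt /B /r; case: ifP => pl.
    have : \sum_(k in win b (nu b)) 76 / 1000 * eta <=
           \sum_(k in win b (nu b)) h l k *+ 2.
      apply: ler_sum => k; rewrite inE => /andP[kS _].
      by have := hS l _ lr kS; clear; lra.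
    rewrite sumr_const -mulr_natl.
    have : (nu b)%:R * (76 / 1000 * eta) <= #|win b (nu b)|%:R * (76 / 1000 * eta).
      by rewrite ler_wpM2r ?ler_nat //; move: eta0; clear; lra.
    by move: n1; clear; lra.
  rewrite big_setU1 ?inE //= big_set1.
  have := hS l _ lr b1S; have := hS l _ lr b2S.
  by move: eta0; clear; case: (leP (h l b.1) (h l b.2)); lra.
(* A pair dominated by b crosses b's window at five times its scale. *)
have cardQ : (#|Q| <= \sum_(b in D) (5 * nu b) ^ 2)%N.
  apply: leq_trans (_ : \sum_(b in D) #|setX (win b (5 * nu b)) (win b (5 * nu b))| <= _)%N;
    last first.
    apply: leq_sum => b _; rewrite cardsX -mulnn; case: (nuP b) => n1 _ nmax.
    have lt5 : (nu b < 5 * nu b)%N by rewrite ltn_Pmull // (leq_trans _ n1).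
    by apply: leq_mul; apply: ltnW; apply: nmax.
  apply: card_le_cover => p pQ; have [b bD /andP[]] := Ddom _ pQ.
  rewrite relC orbb => /andP[lpb zpb] nub; exists b => //.
  have [p1 p2 _ _ eqs] := crossing _ pQ.
  have nbr : (nu p)%:R * eta <= (nu b)%:R * eta by rewrite ler_wpM2r ?(ltW eta0) // ler_nat.
  have inwin k : k \in S -> shadow x y (lam p) k = z p -> k \in win b (5 * nu b).
    move=> kS zk; rewrite inE kS /= natrM.
    have [xk yk] := xyS k kS.
    (* This is where five comes from: a time shift of [nu b * eta / 200] at speed 2 and an offset of
       [nu b * eta / 25] add up to [5 * nu b * eta / 100]. *)
    have := shadow_speed (lam b) (lam p) xk yk.
    have := ler_distD (shadow x y (lam p) k) (shadow x y (lam b) k) (z b).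
    rewrite zk; move: lpb zpb; rewrite natrD (distrC (lam b)) (distrC (z b)).
    by move: nbr; clear; lra.
  by rewrite inE !inwin // -eqs.
have : #|Q|%:R * eta ^+ 2 <= \sum_(b in D) (5 * nu b)%:R ^+ 2 * eta ^+ 2.
  rewrite -mulr_suml ler_wpM2r ?sqr_ge0 //.
  rewrite (eq_bigr (fun b => ((5 * nu b) ^ 2)%:R)) => [|b _]; last by rewrite natrX.
  by rewrite -natr_sum ler_nat.
move/le_trans; apply.
(* The constant is sharp for a crossing without a pile, where [nu b = 100]: it is [25 * 100^2]
   divided by [56/1000 * 1/100]. Piles would allow a smaller one. *)
apply: le_trans (ler_wpM2l _ packed); last by clear; lra.
rewrite mulr_sumr; apply: ler_sum => b bD.
have -> : (5 * nu b)%:R ^+ 2 * eta ^+ 2 = 25 * ((nu b)%:R * eta) ^+ 2 :> R.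
  by rewrite natrM; ring.
rewrite /wt /del; case: (nuP b) => n1 npile _; case: ifP => pl.
  have -> : 25 * 10 ^+ 9 / 56 * (36 / 1000 * ((nu b)%:R * eta) * (((nu b)%:R * eta / 400) *+ 2))
     = 25 * 10 ^+ 5 / 56 * (9 / 5) * ((nu b)%:R * eta) ^+ 2 :> R by field.
  by rewrite ler_wpM2r ?sqr_ge0 //; clear; lra.
case: npile => [->|]; last by move=> npile; move: pl; rewrite /pile npile.
have -> : 25 * (100%:R * eta) ^+ 2 = 25 * 10 ^+ 4 * eta ^+ 2 :> R by ring.
have -> : 25 * 10 ^+ 9 / 56 * (56 / 1000 * eta * ((eta / 200) *+ 2)) = 25 * 10 ^+ 4 * eta ^+ 2 :> R.
  by field.
by [].
Qed.

(* What is left of the barrier property in one direction: up to [z], finitely many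
   intervals containing all [[t k - h k, t k + h k]] have total length at least [A]. *)
Definition covers (R : numDomainType) (K : Type) (t h : K -> R) (A z : R) :=
  forall (J : finType) (c r : J -> R), (forall j, 0 <= r j) ->
    (forall k, exists j, `|t k - c j| + h k <= r j) ->
    A <= z + \sum_j r j *+ 2.

(** The pieces have total length at most [A + w0], and no cover is shorter than [A - z]; merging
    pieces into intervals can thus save at most [w0 + z]. *)
Lemma waste_bound (R : realFieldType) (K T : finType) (t h : K -> R) (A z w0 : R)
    (D : {set T}) (B : T -> {set K}) (c r : T -> R) :
    (forall k, 0 <= h k) -> covers t h A z -> \sum_k h k *+ 2 <= A + w0 ->
    (forall b b' k, b \in D -> b' \in D -> k \in B b -> k \in B b' -> b = b') ->
    (forall b, b \in D -> 0 <= r b) ->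
    (forall b k, b \in D -> k \in B b -> `|t k - c b| + h k <= r b) ->
  \sum_(b in D) (\sum_(k in B b) h k *+ 2 - r b *+ 2) <= w0 + z.
Proof.
move=> h0 cov tot Bdis r0 BI.
(* Replacing the pieces of each B b by one interval still gives a cover. *)
pose used k := [exists b in D, k \in B b].
have := cov (K + T)%type
  (fun j => match j with inl k => t k | inr b => c b end)
  (fun j => match j with inl k => if used k then 0 else h k
                       | inr b => if b \in D then r b else 0 end).
rewrite big_sumType /= => /(_ _ _)/wrap[].
- by case=> [k|b]; case: ifP => // bD; exact: r0.
- move=> k; have [/exists_inP[b bD kB]|nk] := boolP (used k).
    by exists (inr b); rewrite bD; exact: BI.
  by exists (inl k); rewrite (negbTE nk) subrr normr0 add0r.
rewrite (eq_bigr (fun b => if b \in D then r b *+ 2 else 0)); last first.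
  by move=> b _; case: ifP => // _; rewrite mul0rn.
rewrite -big_mkcond /= sumrB.
have -> : \sum_k (if used k then 0 else h k) *+ 2 =
    \sum_k h k *+ 2 - \sum_k (if used k then h k else 0) *+ 2.
  rewrite -sumrB; apply: eq_bigr => k _.
  by case: ifP => _; rewrite mul0rn ?subrr ?subr0.
have : \sum_(b in D) \sum_(k in B b) h k *+ 2 <=
    \sum_k (if used k then h k else 0) *+ 2.
  rewrite (exchange_big_dep predT) //=; apply: ler_sum => k _.
  case: ifP => [/exists_inP[b bD kB]|/negbT nk].
    rewrite (bigD1 b) ?bD //= big_pred0 ?addr0 // => b'.
    apply/negP => /andP[/andP[b'D kB'] /eqP]; apply.
    exact: Bdis kB' kB.
  rewrite big_pred0 ?mul0rn // => b; apply: contraNF nk => /andP[bD kB].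
  by apply/exists_inP; exists b.
move: tot; lra.
Qed.

(** * Short families of segments *)

Lemma normD_normB (R : realFieldType) (a b : R) :
  `|a + b| + `|a - b| = Num.max `|a| `|b| *+ 2.
Proof.
by case: (leP `|a| `|b|); case: (ger0P a); case: (ger0P b);
  case: (ger0P (a + b)); case: (ger0P (a - b)); lra.
Qed.

(* Cauchy-Schwarz, as 148^2 + 23^2 <= 150^2. *)
Lemma skew_le (R : realFieldType) (a b l : R) : 0 <= a -> 0 <= b -> 0 <= l ->
  l ^+ 2 = a ^+ 2 + b ^+ 2 -> 148 * a + 23 * b <= 150 * l.
Proof.
move=> a0 b0 l0 e; rewrite -ler_sqr ?nnegrE; [|lra|lra].
rewrite (_ : (150 * l) ^+ 2 = 22500 * (a ^+ 2 + b ^+ 2)); last by rewrite -e; ring.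
have := sqr_ge0 (149 * a - 851 * b); have := sqr_ge0 b.
by move=> *; nra.
Qed.

Lemma hypot_ge (R : realFieldType) (a b l : R) : 0 <= a -> 0 <= l ->
  l ^+ 2 = a ^+ 2 + b ^+ 2 -> a <= l.
Proof. by move=> a0 l0 e; rewrite -ler_sqr ?nnegrE // e; nra. Qed.

Lemma hypot_le (R : realFieldType) (a b l : R) : 0 <= a -> 0 <= b -> 0 <= l ->
  l ^+ 2 = a ^+ 2 + b ^+ 2 -> l <= a + b.
Proof. by move=> a0 b0 l0 e; rewrite -ler_sqr ?nnegrE ?addr_ge0 // e; nra. Qed.

(** The coefficients differ by 2: over a family whose total length and total of maxima are both
    nearly 2, the right side adds up to nearly 4, the total width of the unit square in the four
    directions. *)
Lemma four_directions (R : realFieldType) (dx dy len l : R) :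
  2 / 25 <= l <= 23 / 25 -> 0 <= len -> len ^+ 2 = dx ^+ 2 + dy ^+ 2 ->
  `|(1 - l) * dx + l * dy| + `|(1 - l) * dx - l * dy| +
  (`|l * dx + (1 - l) * dy| + `|l * dx - (1 - l) * dy|) <=
  12 * len - 10 * Num.max `|dx| `|dy|.
Proof.
move=> /andP[l1 l2] len0; rewrite -(real_normK (num_real dx)) -(real_normK (num_real dy)).
rewrite !normD_normB !normrM (ger0_norm (_ : 0 <= 1 - l)); last by lra.
rewrite (ger0_norm (_ : 0 <= l)); last by lra.
move: (normr_ge0 dx) (normr_ge0 dy); move: `|dx| `|dy| => a b a0 b0 e.
have ea : len ^+ 2 = b ^+ 2 + a ^+ 2 by rewrite addrC.
(* The left side is now twice a sum of two maxima: [2 * a], [2 * b], or at most [46/25 * (a + b)].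
   For the last, [skew_le] times [12/150] gives exactly the required bound. *)
have := skew_le a0 b0 len0 e; have := skew_le b0 a0 len0 ea.
have := hypot_ge a0 len0 e; have := hypot_ge b0 len0 ea.
by case: (leP a b) => ab; case: (leP ((1 - l) * a)); case: (leP (l * a)); nra.
Qed.

(** From [m^2 = (l - M) * (l + M)] with [l + M <= 5/2 * M] and [M < 1000 * m]: a piece away from
    both axis directions pays for its smaller extent by its excess length. *)
Lemma thin_or_skew (R : realFieldType) (M m l : R) : 0 <= m -> m <= M -> 0 <= l ->
  l ^+ 2 = M ^+ 2 + m ^+ 2 -> 1 / 1000 * M < m -> m <= 2500 * (l - M).
Proof.
move=> m0 mM l0 e thick; have M0 : 0 < M by nra.
have lM : l <= 3 / 2 * M by rewrite -ler_sqr ?nnegrE; [nra|lra|lra].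
have : (l - M) * (l + M) = m * m by rewrite -expr2 -subr_sqr e; ring.
move=> e'; rewrite -(ler_pM2r (_ : 0 < l + M)); last by lra.
by rewrite -mulrA e' mulrA mulrC ler_pM2r; lra.
Qed.

(** Pieces have centre [(x, y)] and displacement [(dx, dy)]; [|a| + |b|] is the width of the unit
    square under the functional with coefficients [a], [b]. *)
Definition covering_family (R : numFieldType) (K : Type) (x y dx dy : K -> R) (z : R) :=
  forall a b : R, `|a| <= 1 -> `|b| <= 1 ->
    covers (fun k => a * x k + b * y k) (fun k => `|a * dx k + b * dy k| / 2)
      (`|a| + `|b|) z.

Lemma covering_ge (R : realFieldType) (K : finType) (x y dx dy : K -> R) (z a b : R) :
  covering_family x y dx dy z -> `|a| <= 1 -> `|b| <= 1 ->
  `|a| + `|b| <= z + \sum_k `|a * dx k + b * dy k|.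
Proof.
move=> cov a1 b1.
have := cov a b a1 b1 K (fun k => a * x k + b * y k) (fun k => `|a * dx k + b * dy k| / 2).
move=> /(_ _ _)/wrap[].
- by move=> k; rewrite divr_ge0.
- by move=> k; exists k; rewrite subrr normr0 add0r.
- congr (_ <= _ + _); apply: eq_bigr => k _; lra.
Qed.

Lemma sum_max_ge (R : realFieldType) (K : finType) (x y dx dy : K -> R) (z : R) :
  covering_family x y dx dy z -> 2 - z <= \sum_k Num.max `|dx k| `|dy k|.
Proof.
move=> cov.
have := covering_ge (a := 1) (b := 1) cov; have := covering_ge (a := 1) (b := -1) cov.
rewrite normrN normr1 => /(_ (lexx _) (lexx _)) m /(_ (lexx _) (lexx _)) p.
have : \sum_k `|1 * dx k + -1 * dy k| + \sum_k `|1 * dx k + 1 * dy k| =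
       (\sum_k Num.max `|dx k| `|dy k|) *+ 2.
  rewrite -big_split -sumrMnl; apply: eq_bigr => k _ /=.
  by rewrite !mul1r mulN1r -normD_normB addrC.
lra.
Qed.

(** By [four_directions] and [sum_max_ge] the four totals add up to at most [4 + 13 * eps]; each of
    the other three is at least [1 - eps / 10]. *)
Lemma skew_total_le (R : realFieldType) (K : finType) (x y dx dy len : K -> R)
    (eps l s : R) : 0 <= eps ->
  covering_family x y dx dy (eps / 10) ->
  (forall k, 0 <= len k /\ len k ^+ 2 = dx k ^+ 2 + dy k ^+ 2) ->
  \sum_k len k <= 2 + eps -> 2 / 25 <= l <= 23 / 25 -> s = 1 \/ s = -1 ->
  \sum_k `|(1 - l) * dx k + s * l * dy k| <= 1 + 14 * eps.
Proof.
move=> eps0 cov lenP tot lr s1; have M := sum_max_ge cov.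
pose T1 : R := \sum_k `|(1 - l) * dx k + s * l * dy k|; rewrite -/T1.
pose T2 : R := \sum_k `|(1 - l) * dx k - s * l * dy k|.
pose T3 : R := \sum_k `|l * dx k + (1 - l) * dy k|.
pose T4 : R := \sum_k `|l * dx k - (1 - l) * dy k|.
have four : T1 + T2 + (T3 + T4) <=
    12 * \sum_k len k - 10 * \sum_k Num.max `|dx k| `|dy k|.
  rewrite !mulr_sumr -sumrB -!big_split /=; apply: ler_sum => k _.
  have [len0 lenE] := lenP k; apply: le_trans (four_directions lr len0 lenE).
  case: s1 => ->; rewrite ?mul1r // mulN1r !mulNr opprK.
  by rewrite (addrC `|(1 - l) * dx k - l * dy k|).
have [l0 l1] : `|l| = l /\ `|1 - l| = 1 - l by split; rewrite ger0_norm //; move: lr; clear; lra.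
have sl : `|s * l| = l by case: s1 => ->; rewrite normrM ?normrN normr1 mul1r.
have nsl : `|- (s * l)| = l by rewrite normrN.
have nl1 : `|- (1 - l)| = 1 - l by rewrite normrN.
have le1 : l <= 1 by lra. have le1' : 1 - l <= 1 by lra.
have := covering_ge (a := 1 - l) (b := - (s * l)) cov.
have := covering_ge (a := l) (b := 1 - l) cov.
have := covering_ge (a := l) (b := - (1 - l)) cov.
rewrite nsl nl1 l0 l1 => /(_ le1 le1') c4 /(_ le1 le1') c3 /(_ le1' le1) c2.
have {}c4 : l + (1 - l) <= eps / 10 + T4.
  by move: c4; congr (_ <= _ + _); apply: eq_bigr => k _; rewrite mulNr.
have {}c2 : 1 - l + l <= eps / 10 + T2.
  by move: c2; congr (_ <= _ + _); apply: eq_bigr => k _; rewrite mulNr.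
move: four tot M c2 c3 c4 eps0; rewrite -/T3; clear; lra.
Qed.


(** * Nearly horizontal and nearly vertical pieces *)

(** The excess [len - max] pays for pieces that are not thin. The factor [2500 * 1000] occurs when
    [|dx|] is the larger extent but less than [1000 * |dy|], where [thin_or_skew] bounds [|dy|]. *)
Lemma few_thick (R : realFieldType) (dx dy len : R) :
  0 <= len -> len ^+ 2 = dx ^+ 2 + dy ^+ 2 ->
  `|dx| + `|dy| <= 1001 / 1000 * len + 2500 * (len - Num.max `|dx| `|dy|) /\
  (~~ ((len != 0) && (`|dy| <= 1 / 1000 * `|dx|)) ->
   `|dx| <= 1 / 1000 * len + (2500 * 1000) * (len - Num.max `|dx| `|dy|)).
Proof.
move=> len0; rewrite -(real_normK (num_real dx)) -(real_normK (num_real dy)).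
move: (normr_ge0 dx) (normr_ge0 dy); move: `|dx| `|dy| => a b a0 b0 e.
have ea : len ^+ 2 = b ^+ 2 + a ^+ 2 by rewrite addrC.
have := hypot_ge a0 len0 e; have := hypot_ge b0 len0 ea => lb la.
rewrite negb_and negbK.
have thickab := thin_or_skew b0 _ len0 e; have thickba := thin_or_skew a0 _ len0 ea.
clear e ea.
case: (leP a b) => ab.
  have {}thickba := thickba ab.
  case: (ltP (1 / 1000 * b) a) => [/thickba t|t].
    split; first by lra.
    by move=> _; lra.
  by split=> [|_]; lra.
have {}thickab := thickab (ltW ab).
case: (ltP (1 / 1000 * a) b) => [thick|t].
  by have t := thickab thick; split=> [|_]; lra.
split; first by lra.
by case/orP => [/eqP l0|//]; lra.
Qed.

(** The condition [l != 0] excludes degenerate pieces, which satisfy the slope bound trivially and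
    would spoil the counts. *)
Definition flat (R : numFieldType) (u v l : R) := (l != 0) && (`|v| <= 1 / 1000 * `|u|).

(** Both axis projections have total at least [1 - eps / 10], and [few_thick] bounds their sum by
    little more than 2, so neither is much above 1. The total excess is at most [11/10 * eps], so
    even the factor [2500 * 1000] leaves little outside the flat pieces. *)
Lemma extent (R : realFieldType) (K : finType) (x y dx dy len : K -> R) (eps : R) :
    0 <= eps -> eps <= (1 / 1000) ^+ 4 ->
    covering_family x y dx dy (eps / 10) ->
    (forall k, 0 <= len k /\ len k ^+ 2 = dx k ^+ 2 + dy k ^+ 2) ->
    \sum_k len k <= 2 + eps ->
  \sum_k `|dx k| <= 5011 / 5000 /\
  4989 / 5000 <= \sum_(k | flat (dx k) (dy k) (len k)) `|dx k|.
Proof.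
move=> eps0 eps1 cov lenP tot; have M := sum_max_ge cov.
set SM := \sum_k Num.max _ _ in M.
have norm1 : `|1 : R| <= 1 by rewrite normr1.
have norm0 : `|0 : R| <= 1 by rewrite normr0.
have X : 1 <= eps / 10 + \sum_k `|dx k|.
  have := covering_ge cov norm1 norm0; rewrite normr1 normr0 addr0.
  by congr (_ <= _ + _); apply: eq_bigr => k _; rewrite mul1r mul0r addr0.
have Y : 1 <= eps / 10 + \sum_k `|dy k|.
  have := covering_ge cov norm0 norm1; rewrite normr1 normr0 add0r.
  by congr (_ <= _ + _); apply: eq_bigr => k _; rewrite mul1r mul0r add0r.
have XY : \sum_k `|dx k| + \sum_k `|dy k| <=
    1001 / 1000 * \sum_k len k + 2500 * (\sum_k len k - SM).
  rewrite -sumrB !mulr_sumr -!big_split; apply: ler_sum => k _ /=.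
  by have [l0 lE] := lenP k; case: (few_thick l0 lE).
have N : \sum_(k | ~~ flat (dx k) (dy k) (len k)) `|dx k| <=
    1 / 1000 * \sum_k len k + (2500 * 1000) * (\sum_k len k - SM).
  rewrite -sumrB !mulr_sumr -!big_split /= big_mkcond; apply: ler_sum => k _ /=.
  have [l0 lE] := lenP k; case: (few_thick l0 lE) => _.
  rewrite /flat; case: ifP => [_ /(_ isT)//|_ _].
  rewrite addr_ge0 ?mulr_ge0 ?subr_ge0 //; [lra|].
  rewrite ge_max; apply/andP; split.
    by apply: (hypot_ge (b := dy k)); rewrite // real_normK ?num_real.
  by apply: (hypot_ge (b := dx k)); rewrite // real_normK ?num_real // addrC.
rewrite (bigID (fun k => flat (dx k) (dy k) (len k))) /= in X XY *.
by move: X XY N Y M tot eps0 eps1; clear; lra.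
Qed.

Lemma covering_swap (R : numFieldType) (K : Type) (x y dx dy : K -> R) (z : R) :
  covering_family x y dx dy z -> covering_family y x dy dx z.
Proof.
move=> cov a b a1 b1 J c r r0 cr; rewrite addrC; apply: (cov b a b1 a1 J c r r0) => k.
by have [j] := cr k; exists j; rewrite (addrC (b * x k)) (addrC (b * dx k)).
Qed.

Lemma flat_bounds (R : realFieldType) (dx dy len eta : R) :
  0 < eta -> 0 <= len -> len ^+ 2 = dx ^+ 2 + dy ^+ 2 ->
  len = 0 \/ 99 / 100 * eta <= len <= eta -> flat dx dy len ->
  98 / 100 * eta <= `|dx| <= eta /\ `|dy| <= 1 / 1000 * `|dx|.
Proof.
move=> eta0 l0; rewrite -(real_normK (num_real dx)) -(real_normK (num_real dy)).
move: (normr_ge0 dx) (normr_ge0 dy); rewrite /flat.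
move: `|dx| `|dy| => a b a0 b0 e [->|/andP[l1 l2]]; first by rewrite eqxx.
case/andP => _ ba; have := hypot_ge a0 l0 e; have := hypot_le a0 b0 l0 e.
by move: eta0 l1 l2 ba; clear => *; split; lra.
Qed.

(** Flat pieces have [|dx|] close to [eta], so bounds on total extent become counts. For the window
    bound, [waste_bound] is used with a single family and an interval of length [2/5 + eta]. *)
Lemma flat_count (R : realFieldType) (K : finType) (x y dx dy len : K -> R) (eta eps : R) :
    0 < eta -> eta <= 1 / 1000 -> 0 <= eps -> eps <= (1 / 1000) ^+ 4 ->
    (forall k, 0 <= len k /\ len k ^+ 2 = dx k ^+ 2 + dy k ^+ 2) ->
    (forall k, len k = 0 \/ 99 / 100 * eta <= len k <= eta) ->
    \sum_k len k <= 2 + eps ->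
    covering_family x y dx dy (eps / 10) ->
  [/\ 4989 / 5000 <= #|[set k | flat (dx k) (dy k) (len k)]|%:R * eta,
    #|[set k | flat (dx k) (dy k) (len k)]|%:R * eta <= 1023 / 1000 &
    forall c, #|[set k | flat (dx k) (dy k) (len k) & `|x k - c| <= 1 / 5]|%:R * eta
       <= 412 / 1000].
Proof.
move=> eta0 eta1 eps0 eps1 lenP leneta tot cov.
have [X H] := extent eps0 eps1 cov lenP tot.
have flatP k : flat (dx k) (dy k) (len k) -> 98 / 100 * eta <= `|dx k| <= eta.
  by move=> fl; have [l0 lE] := lenP k; have [] := flat_bounds eta0 l0 lE (leneta k) fl.
have card_le (A : {set K}) : (forall k, k \in A -> flat (dx k) (dy k) (len k)) ->
    #|A|%:R * (98 / 100 * eta) <= \sum_(k in A) `|dx k|.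
  move=> Af; rewrite mulr_natl -sumr_const; apply: ler_sum => k /Af/flatP.
  by case/andP.
split.
- apply: le_trans H _; rewrite mulr_natl -sumr_const.
  rewrite (eq_bigl (fun k => k \in [set k | flat (dx k) (dy k) (len k)])); last first.
    by move=> k; rewrite inE.
  by apply: ler_sum => k; rewrite inE => /flatP/andP[].
- have := card_le [set k | flat (dx k) (dy k) (len k)].
  move=> /(_ _)/wrap[]; first by move=> k; rewrite inE.
  have : \sum_(k in [set k | flat (dx k) (dy k) (len k)]) `|dx k| <= \sum_k `|dx k|.
    by rewrite [leLHS]big_mkcond; apply: ler_sum => k _; case: ifP.
  by move: X; clear; lra.
move=> c; set A := [set k | _ & _].
have Af k : k \in A -> flat (dx k) (dy k) (len k) by rewrite inE => /andP[].
have norm1 : `|1 : R| <= 1 by rewrite normr1.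
have norm0 : `|0 : R| <= 1 by rewrite normr0.
have h0 k : 0 <= `|1 * dx k + 0 * dy k| / 2 by rewrite divr_ge0.
have e1 : \sum_k (`|1 * dx k + 0 * dy k| / 2) *+ 2 <= `|1 : R| + `|0 : R| + (\sum_k `|dx k| - 1).
  rewrite normr1 normr0 addr0 addrC subrK.
  by clear; apply: ler_sum => k _; rewrite mul1r mul0r addr0; lra.
have := @waste_bound _ K unit _ _ _ _ _ setT (fun=> A) (fun=> c) (fun=> 1 / 5 + eta / 2)
   h0 (cov _ _ norm1 norm0) e1.
move=> /(_ _ _ _)/wrap[].
- by move=> [] [].
- by move=> _ _; move: eta0; clear; lra.
- move=> _ k _; rewrite !mul0r !addr0 (mul1r (x k)) (mul1r (dx k)) inE => /andP[/flatP/andP[_ d1] d2].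
  by move: d1 d2; clear; lra.
rewrite big_const cardsT card_unit /= addr0.
rewrite (eq_bigr (fun k => `|dx k|)); last first.
  by move=> k _; rewrite mul1r mul0r addr0; lra.
have := card_le A Af; move: X eps0 eps1 eta1; clear; lra.
Qed.

(** * Crossings of horizontal with vertical pieces *)

(** The direction of the line joining two centres with differences [X], [Y] of opposite signs;
    [1/11] is [1/5] divided by [1/5 + 2]. *)
Lemma crossing_parameter (R : realFieldType) (X Y : R) :
  1 / 5 < `|X| -> 1 / 5 < `|Y| -> `|X| <= 2 -> `|Y| <= 2 -> X * Y < 0 ->
  1 / 11 <= `|X| / (`|X| + `|Y|) <= 10 / 11 /\
  (1 - `|X| / (`|X| + `|Y|)) * X + `|X| / (`|X| + `|Y|) * Y = 0.
Proof.
move=> X1 Y1 X2 Y2 XY.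
have S0 : 0 < `|X| + `|Y| by lra.
split; first by rewrite ler_pdivlMr // ler_pdivrMr //; lra.
have -> : (1 - `|X| / (`|X| + `|Y|)) * X + `|X| / (`|X| + `|Y|) * Y =
  (`|Y| * X + `|X| * Y) / (`|X| + `|Y|) by field; lra.
suff -> : `|Y| * X + `|X| * Y = 0 by rewrite mul0r.
case: (ltrgt0P X) X1 XY => // x0; case: (ltrgt0P Y) Y1 => // y0 *; try lra; nra.
Qed.

Lemma flat_width (R : realFieldType) (eta a b l m : R) :
  2 / 25 <= m -> 0 <= l -> l + m = 1 ->
  98 / 100 * eta <= `|a| <= eta /\ `|b| <= 1 / 1000 * `|a| ->
  38 / 1000 * eta <= `|m * a + l * b| / 2 <= eta / 2.
Proof.
move=> m0 l0 lm [/andP[a1 a2] ba].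
have := ler_normD (m * a) (l * b); have := lerB_normD (m * a) (l * b).
rewrite !normrM (ger0_norm l0) (ger0_norm (_ : 0 <= m)); last by move: m0; clear; lra.
have b0 := normr_ge0 b; have -> : l = 1 - m by move: lm; clear; lra.
have m1 : m <= 1 by move: lm l0; clear; lra.
by move: (normr_ge0 a) b0 a1 a2 ba m0 m1; clear; move: `|a| `|b| `|_ + _| => u v w *;
  apply/andP; split; nra.
Qed.

(** In units of [eta^-2] there are about 1 pairs in all; those close in [x], and likewise in [y],
    amount to at most [1023/1000 * 412/1000 < 422/1000]. *)
Lemma many_separated_pairs (R : realFieldType) (K : finType) (H V : {set K})
    (x y : K -> R) (eta : R) : 0 < eta ->
    4989 / 5000 <= #|H|%:R * eta <= 1023 / 1000 ->
    4989 / 5000 <= #|V|%:R * eta <= 1023 / 1000 ->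
    (forall c, #|[set k in H | `|x k - c| <= 1 / 5]|%:R * eta <= 412 / 1000) ->
    (forall c, #|[set k in V | `|y k - c| <= 1 / 5]|%:R * eta <= 412 / 1000) ->
  15 / 100 <= #|[set p in setX H V |
    (1 / 5 < `|x p.1 - x p.2|) && (1 / 5 < `|y p.1 - y p.2|)]|%:R * eta ^+ 2.
Proof.
move=> eta0 /andP[H1 H2] /andP[V1 V2] Hw Vw; set G := [set p in setX H V | _].
pose A c := [set k in H | `|x k - c| <= 1 / 5].
pose B c := [set k in V | `|y k - c| <= 1 / 5].
pose GA := [set p in setX H V | `|x p.1 - x p.2| <= 1 / 5].
pose GB := [set p in setX H V | `|y p.1 - y p.2| <= 1 / 5].
have sub : setX H V \subset G :|: (GA :|: GB).
  apply/subsetP => p pHV; rewrite !inE; rewrite inE in pHV; rewrite pHV /=.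
  by case: ltP => //= _; case: leP => //=; rewrite orbT.
have cGA : (#|GA| <= \sum_(j in V) #|A (x j)|)%N.
  apply: leq_trans (card_le_cover (D := V) (X := fun j => setX (A (x j)) [set j]) _) _.
    case=> i j; rewrite !inE /= => /andP[/andP[iH jV] xij]; exists j => //.
    by rewrite !inE /= iH xij eqxx.
  by apply: leq_sum => j _; rewrite cardsX cards1 muln1.
have cGB : (#|GB| <= \sum_(i in H) #|B (y i)|)%N.
  apply: leq_trans (card_le_cover (D := H) (X := fun i => setX [set i] (B (y i))) _) _.
    case=> i j; rewrite !inE /= => /andP[/andP[iH jV] yij]; exists i => //.
    by rewrite !inE /= jV distrC yij eqxx.
  by apply: leq_sum => j _; rewrite cardsX cards1 mul1n.
have scale (P : {set K}) (f : K -> {set K}) (g : nat) :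
    (forall k, #|f k|%:R * eta <= 412 / 1000) -> #|P|%:R * eta <= 1023 / 1000 ->
    (g <= \sum_(k in P) #|f k|)%N -> g%:R * eta ^+ 2 <= 422 / 1000.
  move=> fb Pb gle; have e0 : 0 <= eta := ltW eta0.
  apply: (@le_trans _ _ (\sum_(k in P) 412 / 1000 * eta)).
    rewrite expr2 mulrA -mulr_suml ler_wpM2r //.
    apply: (@le_trans _ _ ((\sum_(k in P) #|f k|)%:R * eta)).
      by rewrite ler_wpM2r // ler_nat.
    by rewrite natr_sum mulr_suml; apply: ler_sum.
  by rewrite sumr_const -mulr_natl; move: Pb; clear; lra.
have rGA := scale V (fun k => A (x k)) #|GA| (fun k => Hw (x k)) V2 cGA.
have rGB := scale H (fun k => B (y k)) #|GB| (fun k => Vw (y k)) H2 cGB.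
have : #|setX H V|%:R * eta ^+ 2 <= (#|G| + (#|GA| + #|GB|))%:R * eta ^+ 2.
  rewrite ler_wpM2r ?sqr_ge0 // ler_nat; apply: leq_trans (subset_leq_card sub) _.
  apply: leq_trans (leq_card_setU _ _) _.
  by rewrite leq_add2l leq_card_setU.
rewrite cardsX natrM expr2 mulrACA !natrD -expr2 !mulrDl.
move: H1 V1 rGA rGB; clear.
by move: (#|H|%:R * eta) (#|V|%:R * eta) => a b *; nra.
Qed.

(** The sign [s] reflects the second coordinate, so that [few_crossings] serves connecting lines of
    either slope. The waste is [14 * eps] from [skew_total_le] plus the tolerance [eps / 10]. *)
Lemma few_skew_crossings (R : realType) (K : finType) (H V : {set K})
    (x y dx dy len : K -> R) (eta eps s : R) (G : {set K * K}) :
    0 < eta -> eta <= 1 / 1000 -> 0 <= eps ->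
    s = 1 \/ s = -1 ->
    (forall k, `|x k| <= 1 /\ `|y k| <= 1) ->
    (forall k, 0 <= len k /\ len k ^+ 2 = dx k ^+ 2 + dy k ^+ 2) ->
    \sum_k len k <= 2 + eps ->
    covering_family x y dx dy (eps / 10) ->
    #|H :|: V|%:R * eta <= 21 / 10 ->
    (forall k, k \in H -> 98 / 100 * eta <= `|dx k| <= eta /\
      `|dy k| <= 1 / 1000 * `|dx k|) ->
    (forall k, k \in V -> 98 / 100 * eta <= `|dy k| <= eta /\
      `|dx k| <= 1 / 1000 * `|dy k|) ->
    (forall p, p \in G -> [/\ p.1 \in H, p.2 \in V & p.1 != p.2] /\
       [/\ 1 / 5 < `|x p.1 - x p.2|, 1 / 5 < `|y p.1 - y p.2| &
         s * ((x p.1 - x p.2) * (y p.1 - y p.2)) < 0]) ->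
  #|G|%:R * eta ^+ 2 <= 25 * 10 ^+ 9 / 56 * (14 * eps + eps / 10).
Proof.
move=> eta0 eta1 eps0 s1 xy1 lenP tot cov Seta HP VP GP.
have ns a : `|s * a| = `|a| by case: s1 => ->; rewrite normrM ?normrN normr1 mul1r.
pose X p := x p.1 - x p.2; pose Y p := s * (y p.1 - y p.2).
have nD (a b : R) : `|a| <= 1 -> `|b| <= 1 -> `|a - b| <= 2.
  by move=> a1 b1; apply: le_trans (ler_normB _ _) _; move: a1 b1; clear; lra.
pose h (l : R) k := `|(1 - l) * dx k + s * l * dy k| / 2.
apply: (@few_crossings _ _ (H :|: V) x (fun k => s * y k) h _ _ _
  (fun p => `|X p| / (`|X p| + `|Y p|))) => //.
- by move=> k _; rewrite ns; exact: xy1.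
- move=> l k lr kS; rewrite /h.
  have [l1 l2 l3 l4] : [/\ 2 / 25 <= 1 - l, 2 / 25 <= l, 0 <= l & 0 <= 1 - l].
    by move: lr; clear; split; lra.
  have -> : s * l * dy k = l * (s * dy k) by rewrite mulrCA mulrA.
  case/setUP: kS => [/HP|/VP] kP.
    by apply: flat_width => //; rewrite ?ns // addrC subrK.
  by rewrite addrC; apply: flat_width => //; rewrite ?ns // subrK.
- move=> l lr D B c r Bd r0 BI.
  have l1 : `|1 - l| <= 1 by rewrite ler_norml; move: lr; clear; lra.
  have l2 : `|s * l| <= 1 by rewrite ns ler_norml; move: lr; clear; lra.
  apply: (waste_bound _ (cov _ _ l1 l2) _ Bd r0 _) => [k||b k bD kB].
  + by rewrite divr_ge0.
  + have -> : `|1 - l| + `|s * l| = 1.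
      by rewrite ns !ger0_norm; move: lr; clear; lra.
    apply: le_trans (skew_total_le eps0 cov lenP tot lr s1).
    by apply: ler_sum => k _; clear; lra.
  + have := BI b k bD kB; rewrite /shadow /h; congr (`|_ - _| + _ <= _).
    by congr (_ + _); rewrite mulrCA mulrA.
- move=> p pG; have [[p1 p2 p12] [x12 y12 neg]] := GP p pG.
  have Y2 : 1 / 5 < `|Y p| by rewrite ns.
  have XY : X p * Y p < 0 by rewrite /Y mulrCA.
  have [lr eq0] := crossing_parameter x12 Y2 (nD _ _ (xy1 _).1 (xy1 _).1)
    (eq_ind_r (fun v => v <= 2) (nD _ _ (xy1 _).2 (xy1 _).2) (ns _)) XY.
  split=> //; [by rewrite inE p1|by rewrite inE p2 orbT|].
  apply/eqP; rewrite -subr_eq0 -[X in _ == X]eq0 /shadow; apply/eqP.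
  by rewrite /X /Y; ring.
Qed.

Lemma no_short_family (R : realType) (K : finType) (x y dx dy len : K -> R)
    (eta eps : R) :
    0 < eta -> eta <= 1 / 1000 -> 0 <= eps -> eps <= (1 / 1000) ^+ 4 ->
    (forall k, `|x k| <= 1 /\ `|y k| <= 1) ->
    (forall k, 0 <= len k /\ len k ^+ 2 = dx k ^+ 2 + dy k ^+ 2) ->
    (forall k, len k = 0 \/ 99 / 100 * eta <= len k <= eta) ->
    covering_family x y dx dy (eps / 10) ->
  2 + eps < \sum_k len k.
Proof.
move=> eta0 eta1 eps0 eps1 xy1 lenP leneta cov; rewrite ltNge; apply/negP => tot.
have lenP' k : 0 <= len k /\ len k ^+ 2 = dy k ^+ 2 + dx k ^+ 2.
  by rewrite addrC; exact: lenP.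
have [H1 H2 Hw] := flat_count eta0 eta1 eps0 eps1 lenP leneta tot cov.
have [V1 V2 Vw] := flat_count eta0 eta1 eps0 eps1 lenP' leneta tot (covering_swap cov).
pose H := [set k | flat (dx k) (dy k) (len k)].
pose V := [set k | flat (dy k) (dx k) (len k)].
have HP k : k \in H -> 98 / 100 * eta <= `|dx k| <= eta /\ `|dy k| <= 1 / 1000 * `|dx k|.
  by rewrite inE; apply: flat_bounds => //; [case: (lenP k)..].
have VP k : k \in V -> 98 / 100 * eta <= `|dy k| <= eta /\ `|dx k| <= 1 / 1000 * `|dy k|.
  by rewrite inE; apply: flat_bounds => //; [case: (lenP' k)..].
have HV k : k \in H -> k \in V -> False.
  by move=> /HP[/andP[a1 a2] b1] /VP[/andP[c1 c2] d1]; move: eta0 a1 a2 b1 c1 d1; clear; lra.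
have Hw' c : #|[set k in H | `|x k - c| <= 1 / 5]|%:R * eta <= 412 / 1000.
  apply: le_trans (Hw c); rewrite ler_wpM2r ?(ltW eta0) // ler_nat; apply: subset_leq_card.
  by apply/subsetP => k; rewrite !inE.
have Vw' c : #|[set k in V | `|y k - c| <= 1 / 5]|%:R * eta <= 412 / 1000.
  apply: le_trans (Vw c); rewrite ler_wpM2r ?(ltW eta0) // ler_nat; apply: subset_leq_card.
  by apply/subsetP => k; rewrite !inE.
have := many_separated_pairs eta0 _ _ Hw' Vw'; rewrite H1 H2 V1 V2 => /(_ isT isT).
set G := [set p in _ | _] => many.
pose Q (s : R) := [set p in G | s * ((x p.1 - x p.2) * (y p.1 - y p.2)) < 0].
have Seta : #|H :|: V|%:R * eta <= 21 / 10.
  have : #|H :|: V|%:R * eta <= #|H|%:R * eta + #|V|%:R * eta.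
    by rewrite -mulrDl -natrD ler_wpM2r ?(ltW eta0) // ler_nat leq_card_setU.
  by move: H2 V2; rewrite -/H -/V; clear; lra.
have few s : s = 1 \/ s = -1 ->
    #|Q s|%:R * eta ^+ 2 <= 25 * 10 ^+ 9 / 56 * (14 * eps + eps / 10).
  move=> s1; apply: (few_skew_crossings (H := H) (V := V) eta0 eta1 eps0 s1 xy1 lenP tot cov)
    => // p; rewrite inE => /andP[].
  rewrite inE => /andP[]; rewrite inE => /andP[p1 p2] /andP[x1 y1] neg; split; split=> //.
  by apply/eqP => p12; rewrite p12 in p1; exact: HV p1 p2.
have f1 := few 1 (or_introl erefl); have f2 := few (-1) (or_intror erefl).
have : #|G|%:R * eta ^+ 2 <= #|Q 1|%:R * eta ^+ 2 + #|Q (-1)|%:R * eta ^+ 2.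
  rewrite -mulrDl ler_wpM2r ?sqr_ge0 // -natrD ler_nat.
  apply: leq_trans (leq_card_setU _ _); apply: subset_leq_card; apply/subsetP => p pG.
  rewrite !inE in pG *; rewrite pG /= mul1r mulN1r oppr_lt0.
  case/andP: pG => _ /andP[x1 y1]; rewrite -neq_lt mulf_neq0 // -normr_gt0.
    by move: x1; clear; lra.
  by move: y1; clear; lra.
(* The two upper bounds add up to less than [13/1000] when [eps <= 10^-12], against the lower bound
   [15/100]. *)
move: f1 f2 many eps0 eps1; clear.
move: (#|G|%:R * _) (#|Q 1|%:R * _) (#|Q (-1)|%:R * _) => a b c *; lra.
Qed.

(** * Cutting segments into pieces of nearly equal length *)

Lemma common_mesh (R : realFieldType) (s : seq R) : (forall l, l \in s -> 0 <= l) ->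
  exists eta : R, [/\ 0 < eta, eta <= 1 / 1000 &
    forall l, l \in s -> l = 0 \/ 100 * eta <= l].
Proof.
elim: s => [_|l s IH sp]; first by exists (1 / 1000); split=> //; lra.
have [|eta [eta0 eta1 etas]] := IH; first by move=> k ks; apply: sp; rewrite inE ks orbT.
have := sp l (mem_head _ _); rewrite le_eqVlt => /predU1P[<-|l0].
  by exists eta; split=> // k; rewrite inE => /predU1P[->|/etas]; [left|].
exists (Num.min eta (l / 100)); split.
- by rewrite lt_min eta0 divr_gt0.
- by rewrite ge_min eta1.
- move=> k; rewrite inE => /predU1P[->|/etas[|h]]; [right|by left|right].
    have : Num.min eta (l / 100) <= l / 100 by rewrite ge_min lexx orbT.
    by clear; lra.
  have : Num.min eta (l / 100) <= eta by rewrite ge_min lexx.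
  by move: h; clear; lra.
Qed.

(** With one piece more than the integer part of [l / eta], pieces are at most [eta] long; as
    [l >= 100 * eta], the extra piece costs under one percent. *)
Lemma piece_count (R : realType) (eta l : R) : 0 < eta -> l = 0 \/ 100 * eta <= l ->
  exists n : nat, (0 < n)%N /\ (l / n%:R = 0 \/ 99 / 100 * eta <= l / n%:R <= eta).
Proof.
move=> eta0 [->|l0]; first by exists 1%N; split=> //; left; rewrite mul0r.
have le0 : 0 <= l / eta by rewrite divr_ge0 //; move: eta0 l0; clear; lra.
have /andP[n1 n2] := truncn_itv le0; set n := Num.truncn _ in n1 n2.
exists n.+1; split=> //; right.
have npos : 0 < n.+1%:R :> R by rewrite ltr0n.
rewrite ler_pdivlMr // ler_pdivrMr //; move: n1 n2; rewrite ler_pdivlMr // ltr_pdivrMr //.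
rewrite -natr1 => n1 n2; have {n2} : l < n%:R * eta + eta by rewrite -[X in _ + X]mul1r -mulrDl.
have -> : 99 / 100 * eta * (n%:R + 1) = 99 / 100 * (n%:R * eta + eta) by ring.
have -> : eta * (n%:R + 1) = n%:R * eta + eta by ring.
by move: l0 n1 eta0; clear; move: (n%:R * eta) => x *; apply/andP; split; lra.
Qed.

Lemma piece_index (R : realType) (n : nat) (tau : R) : (0 < n)%N -> 0 <= tau <= 1 ->
  exists j : 'I_n, j%:R <= tau * n%:R <= j%:R + 1.
Proof.
case: n => // n _ /andP[t0 t1].
have [lt1|ge1] := ltP tau 1.
  have p0 : 0 <= tau * n.+1%:R by rewrite mulr_ge0.
  have /andP[n1 n2] := truncn_itv p0.
  have jn : (Num.truncn (tau * n.+1%:R) < n.+1)%N.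
    rewrite -(ltr_nat R); apply: le_lt_trans n1 _.
    by rewrite gtr_pMl // ltr0n.
  by exists (Ordinal jn); rewrite /= n1 natr1 ltW.
(* The endpoint [tau = 1] goes to the last piece, since truncation would give an index out of
   range. *)
exists ord_max; rewrite (_ : tau = 1) /= ?mul1r ?natr1 ?lexx ?ler_nat ?leqnSn //.
by apply/eqP; rewrite eq_le t1 ge1.
Qed.

(** Only points need covering here: one segment may be shared among several intervals. The statement
    thus does not depend on a subdivision into pieces. *)
Definition segment_cover (R : realType) (E : seq ((R * R) * (R * R))) (z : R) :=
  forall a b : R, `|a| <= 1 -> `|b| <= 1 ->
  forall (J : finType) (c r : J -> R), (forall j, 0 <= r j) ->
    (forall e (tau : R), e \in E -> 0 <= tau <= 1 -> exists j,
      `|a * (e.1.1 + tau * (e.2.1 - e.1.1)) + b * (e.1.2 + tau * (e.2.2 - e.1.2)) - c j|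
        <= r j) ->
  `|a| + `|b| <= z + \sum_j r j *+ 2.

Lemma no_short_segments (R : realType) (E : seq ((R * R) * (R * R)))
    (len : (R * R) * (R * R) -> R) (eps : R) :
    0 <= eps -> eps <= (1 / 1000) ^+ 4 ->
    (forall e, e \in E -> [/\ `|e.1.1| <= 1, `|e.1.2| <= 1, `|e.2.1| <= 1 & `|e.2.2| <= 1]) ->
    (forall e, 0 <= len e /\ len e ^+ 2 = (e.2.1 - e.1.1) ^+ 2 + (e.2.2 - e.1.2) ^+ 2) ->
    segment_cover E (eps / 10) ->
  2 + eps < \sum_(e <- E) len e.
Proof.
move=> eps0 eps1 E1 lenP cov.
have [|eta [eta0 eta1 etaE]] := @common_mesh R [seq len e | e <- E].
  by move=> l /mapP[e _ ->]; case: (lenP e).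
pose T := 'I_(size E).
pose ed (i : T) := tnth (in_tuple E) i.
have edE i : ed i \in E by exact: mem_tnth.
have /fin_all_exists[n nP] : forall i : T, exists n : nat, (0 < n)%N /\
    (len (ed i) / n%:R = 0 \/ 99 / 100 * eta <= len (ed i) / n%:R <= eta).
  by move=> i; apply: piece_count => //; apply: etaE; apply: map_f.
pose K : finType := {i : T & 'I_(n i)}.
pose mid (k : K) : R := ((tagged k)%:R + 1 / 2) / (n (tag k))%:R.
pose dx (k : K) : R := ((ed (tag k)).2.1 - (ed (tag k)).1.1) / (n (tag k))%:R.
pose dy (k : K) : R := ((ed (tag k)).2.2 - (ed (tag k)).1.2) / (n (tag k))%:R.
pose x (k : K) : R := (ed (tag k)).1.1 + mid k * ((ed (tag k)).2.1 - (ed (tag k)).1.1).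
pose y (k : K) : R := (ed (tag k)).1.2 + mid k * ((ed (tag k)).2.2 - (ed (tag k)).1.2).
pose ln (k : K) : R := len (ed (tag k)) / (n (tag k))%:R.
have n0 i : 0 < (n i)%:R :> R by rewrite ltr0n; case: (nP i).
have mid01 k : 0 <= mid k <= 1.
  rewrite ler_pdivlMr // ler_pdivrMr // mul0r mul1r.
  have : ((tagged k).+1)%:R <= (n (tag k))%:R :> R by rewrite ler_nat.
  by have := ler0n R (tagged k); rewrite -natr1; clear; lra.
have convex (p q m : R) : 0 <= m <= 1 -> `|p| <= 1 -> `|q| <= 1 -> `|p + m * (q - p)| <= 1.
  by rewrite !ler_norml => /andP[? ?] /andP[? ?] /andP[? ?]; apply/andP; split; nra.
have -> : \sum_(e <- E) len e = \sum_k ln k.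
  rewrite -(sig_big_dep xpredT (fun _ => xpredT)
     (fun (i : T) (_ : 'I_(n i)) => len (ed i) / (n i)%:R)) /=.
  rewrite -[in LHS](in_tupleE E) big_tuple; apply: eq_bigr => i _.
  by rewrite sumr_const card_ord -[RHS]mulr_natr mulfVK // gt_eqF.
have nsf := @no_short_family R K x y dx dy ln eta eps. apply: nsf => //.
- by move=> k; have [? ? ? ?] := E1 _ (edE (tag k)); split; apply: convex.
- move=> k; have [l0 lE] := lenP (ed (tag k)); split; first by rewrite divr_ge0.
  by rewrite /ln /dx /dy !expr_div_n -mulrDl lE.
- by move=> k; case: (nP (tag k)).
- move=> a b a1 b1 J c r r0 cr; apply: (cov a b a1 b1 J c r r0) => e tau eE t01.
  have [i ->] : exists i, e = ed i.
    by have /tnthP[i ->] : e \in in_tuple E by []; exists i.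
  have [j /andP[j1 j2]] := piece_index (nP i).1 t01.
  pose k : K := Tagged (fun i => 'I_(n i)) j.
  have [j' kj] := cr k; exists j'; apply: le_trans kj.
  (* [s] is the offset from the midpoint of piece [j], measured in pieces. *)
  pose s := tau * (n i)%:R - (j%:R + 1 / 2).
  have s1 : `|s| <= 1 / 2 by rewrite ler_norml /s; move: j1 j2; clear; lra.
  have ni : (n i)%:R != 0 :> R by rewrite gt_eqF.
  have -> : a * ((ed i).1.1 + tau * ((ed i).2.1 - (ed i).1.1)) +
      b * ((ed i).1.2 + tau * ((ed i).2.2 - (ed i).1.2)) - c j' =
      (a * x k + b * y k - c j') + s * (a * dx k + b * dy k).
    by rewrite /x /y /dx /dy /mid /s /=; field.
  apply: le_trans (ler_normD _ _) _; rewrite lerD2l normrM mulrC ler_wpM2l //.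
  by move: s1; clear; lra.
Qed.

From mathcomp Require Import all_classical all_reals all_analysis.
Import Order.TTheory GRing.Theory Num.Theory.
Import numFieldNormedType.Exports.
Local Open Scope classical_set_scope.
Local Open Scope ring_scope.

(** * From curves to segments *)

Lemma curve_local (R : realType) (g : curve R) (c rho : R) : 0 < rho ->
    curve_lo g <= c <= curve_hi g ->
  exists2 d : R, 0 < d & forall x, curve_lo g <= x <= curve_hi g -> `|x - c| < d ->
    `|(g x).1 - (g c).1| <= rho /\ `|(g x).2 - (g c).2| <= rho.
Proof.
move=> rho0 cI.
have /subspace_continuousP/(_ c) := @curve_continuous R g.
rewrite /= in_itv /= => /(_ cI) gc.
have := gc _ (nbhsx_ballx (g c) rho rho0); rewrite /nbhs /= => /nbhs_ballP[d d0 cd].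
exists d => // x xI xc.
have [] := cd x _ _; rewrite /ball /= ?in_itv //=.
  by rewrite distrC.
by rewrite !(distrC (_ c)) => /ltW ? /ltW ?.
Qed.

(** Compactness by a supremum: take the endpoints [y] up to which such a partition exists;
    continuity at their supremum [c] extends one past [c] unless [curve_hi g] is reached. *)
Lemma curve_partition (R : realType) (g : curve R) (rho : R) : 0 < rho ->
  exists s, itv_partition (curve_lo g) (curve_hi g) s /\
    forall x, curve_lo g <= x <= curve_hi g -> exists v, [/\ v \in curve_lo g :: s,
      `|(g x).1 - (g v).1| <= rho & `|(g x).2 - (g v).2| <= rho].
Proof.
move=> rho0; have lohi := curve_le g.
pose S : set R := [set y | curve_lo g <= y <= curve_hi g /\
  exists s, itv_partition (curve_lo g) y s /\
    forall x, curve_lo g <= x <= y -> exists v, [/\ v \in curve_lo g :: s,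
      `|(g x).1 - (g v).1| <= rho & `|(g x).2 - (g v).2| <= rho]].
have Slo : S (curve_lo g).
  split; first by rewrite lexx.
  exists [::]; split; first by split.
  move=> x; rewrite -eq_le => /eqP <-; exists (curve_lo g).
  by rewrite !subrr !normr0 mem_head !ltW.
have Sub : has_sup S.
  by split; [exists (curve_lo g)|exists (curve_hi g) => y [/andP[]]].
pose c := sup S.
have cle y : S y -> y <= c by move=> Sy; exact: (ub_le_sup Sub.2).
have chi : c <= curve_hi g by apply: ge_sup Sub.1 _ => y [/andP[]].
have cI : curve_lo g <= c <= curve_hi g by rewrite cle.
have [d d0 gd] := @curve_local R g c (rho / 2) (divr_gt0 rho0 (ltr0n _ 2)) cI.
have [y [/andP[loy yhi] [s [sy ys]]] cdy] := sup_adherent d0 Sub.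
have yc : y <= c by apply: cle; split; [rewrite loy|exists s].
pose y' := Num.min (c + d / 2) (curve_hi g).
have y'1 : y' <= c + d / 2 by rewrite ge_min lexx.
have y'2 : y' <= curve_hi g by rewrite ge_min lexx orbT.
have [y'y|yy'] := leP y' y.
  suff yhi' : y = curve_hi g by exists s; rewrite -yhi'.
  apply/eqP; rewrite eq_le yhi; move: y'y; rewrite /y' ge_min => /orP[|//].
  by move: yc d0; clear; lra.
have Sy' : S y'.
  split; first by rewrite (le_trans loy (ltW yy')).
  exists (s ++ [:: y']); split; first by apply: itv_partition_cat sy _; exact: itv_partition1.
  move=> x /andP[lox xy']; have [xy|yx] := leP x y.
    have [|v [vs v1 v2]] := ys x; first by rewrite lox.
    by exists v; split=> //; move: vs; rewrite !inE mem_cat => /orP[->//|->]; rewrite orbT.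
  exists y'; rewrite -cat_cons mem_cat mem_seq1 eqxx orbT.
  have cdy' : c - d < y by exact: cdy.
  have clos z : y < z <= y' -> `|(g z).1 - (g c).1| <= rho / 2 /\ `|(g z).2 - (g c).2| <= rho / 2.
    move=> /andP[z1 z2]; apply: gd.
      by rewrite (le_trans loy (ltW z1)) (le_trans z2 y'2).
    by rewrite ltr_norml; move: z1 z2 y'1 cdy' d0; clear => *; lra.
  have [|x1 x2] := clos x; first by rewrite yx.
  have [|z1 z2] := clos y'; first by rewrite yy' lexx.
  split; first by [].
    have := ler_distD (g c).1 (g x).1 (g y').1.
    by rewrite (distrC (g c).1); move: x1 z1; clear; lra.
  have := ler_distD (g c).2 (g x).2 (g y').2.
  by rewrite (distrC (g c).2); move: x2 z2; clear; lra.
have := cle _ Sy'; rewrite /y' ge_min => /orP[|hic]; first by move: d0; clear; lra.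
have hiE : y' = curve_hi g.
  by apply/eqP; rewrite eq_le y'2 le_min lexx andbT; move: hic d0; clear; lra.
by move: Sy'; rewrite hiE => -[_].
Qed.

(** The first index at which [w] lies on the other side of [t] than [w 0] ends the required step. *)
Lemma discrete_ivt (R : realDomainType) (w : nat -> R) (t : R) (i j n : nat) :
    (i <= n)%N -> (j <= n)%N -> w i < t -> t < w j ->
  exists2 k, (k < n)%N & (w k <= t <= w k.+1) || (w k.+1 <= t <= w k).
Proof.
move=> lein lejn wi wj; case: (leP (w 0%N) t) => w0.
  have ex : exists k, t < w k by exists j.
  case: (ex_minnP ex) => -[|k] wk kmin; first by rewrite ltNge w0 in wk.
  exists k; first by apply: leq_trans lejn; exact: kmin.
  rewrite (ltW wk) andbT (leNgt (w k)); apply/orP; left; apply/negP => /kmin.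
  by rewrite ltnn.
have ex : exists k, w k < t by exists i.
case: (ex_minnP ex) => -[|k] wk kmin; first by rewrite ltNge (ltW w0) in wk.
exists k; first by apply: leq_trans lein; exact: kmin.
rewrite (ltW wk) /= (leNgt t (w k)); apply/orP; right; apply/negP => /kmin.
by rewrite ltnn.
Qed.

Lemma between_convex (R : realFieldType) (p q t : R) : (p <= t <= q) || (q <= t <= p) ->
  exists2 tau, 0 <= tau <= 1 & t = p + tau * (q - p).
Proof.
have [->|pq] := eqVneq q p.
  by rewrite orbb -eq_le => /eqP ->; exists 0; rewrite ?lexx ?ler01 // mul0r addr0.
move=> h; exists ((t - p) / (q - p)); last by rewrite divfK ?subr_eq0 // subrKC.
case/orP: h => /andP[h1 h2].
  have d0 : 0 < q - p by rewrite subr_gt0 lt_neqAle eq_sym pq (le_trans h1 h2).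
  by rewrite ler_pdivlMr // ler_pdivrMr // mul0r mul1r subr_ge0 h1 lerD2r.
have d0 : q - p < 0 by rewrite subr_lt0 lt_neqAle pq (le_trans h1 h2).
by rewrite ler_ndivlMr // ler_ndivrMr // mul0r mul1r subr_le0 h2 lerD2r.
Qed.

(* mathcomp-analysis has another [edist], which shadows the one of [Defs]. *)
Local Notation edist := Defs.edist.

(** Moves the centre of the unit square to the origin; the larger square becomes [[-1, 1]^2]. *)
Definition centred (R : realType) (p : R * R) : R * R := (p.1 - 1 / 2, p.2 - 1 / 2).

Lemma edist_centred (R : realType) (p q : R * R) :
  edist (centred p) (centred q) = edist p q.
Proof. by rewrite /edist /centred /= !opprB !addrA !subrK. Qed.

Lemma edist_ge0 (R : realType) (p q : R * R) : 0 <= edist p q.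
Proof. exact: sqrtr_ge0. Qed.

Lemma edist_sqr (R : realType) (p q : R * R) :
  edist p q ^+ 2 = (p.1 - q.1) ^+ 2 + (p.2 - q.2) ^+ 2.
Proof. by rewrite sqr_sqrtr // addr_ge0 ?sqr_ge0. Qed.

Lemma coord_edist (R : realType) (p q : R * R) :
  `|p.1 - q.1| <= edist p q /\ `|p.2 - q.2| <= edist p q.
Proof.
by split; rewrite -(ger0_norm (edist_ge0 p q)) -ler_sqr ?nnegrE //
  !real_normK ?num_real // edist_sqr ?lerDl ?lerDr sqr_ge0.
Qed.

Definition functional (R : realType) (a b : R) (p : R * R) : R := a * p.1 + b * p.2.

Lemma functional_dist (R : realType) (a b rho : R) (p q : R * R) :
  `|a| <= 1 -> `|b| <= 1 -> `|p.1 - q.1| <= rho -> `|p.2 - q.2| <= rho ->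
  `|functional a b (centred p) - functional a b (centred q)| <= rho *+ 2.
Proof.
move=> a1 b1 h1 h2.
have -> : functional a b (centred p) - functional a b (centred q) =
   a * (p.1 - q.1) + b * (p.2 - q.2) by rewrite /functional /centred /=; ring.
apply: le_trans (ler_normD _ _) _; rewrite !normrM mulr2n lerD //.
  by rewrite -[leRHS]mul1r ler_pM.
by rewrite -[leRHS]mul1r ler_pM.
Qed.

Definition vertex (R : realType) (g : curve R) (s : seq R) (k : nat) : R * R :=
  centred (g (nth (curve_lo g) (curve_lo g :: s) k)).
Definition chords (R : realType) (g : curve R) (s : seq R) :=
  [seq (vertex g s k, vertex g s k.+1) | k <- iota 0 (size s)].

Lemma sum_chords (R : realType) (g : curve R) (s : seq R) :
  \sum_(e <- chords g s) edist e.2 e.1 = polygonal_length (curve_lo g) g s.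
Proof.
rewrite /chords big_map /polygonal_length /index_iota subn0.
by apply: eq_bigr => k _; rewrite edist_centred.
Qed.

Lemma finite_argmax (R : realDomainType) (w : nat -> R) (n : nat) :
  exists2 k, (k <= n)%N & forall i, (i <= n)%N -> w i <= w k.
Proof.
elim: n => [|n [k kn kmax]]; first by exists 0%N => // i; rewrite leqn0 => /eqP ->.
have [le|lt] := leP (w n.+1) (w k).
  exists k; first exact: leqW.
  by move=> i; rewrite leq_eqVlt => /predU1P[->|/kmax].
exists n.+1 => // i; rewrite leq_eqVlt => /predU1P[->//|/kmax h].
exact: le_trans h (ltW lt).
Qed.

(** [m] and [M] are the extreme values at the vertices. A value strictly between them is attained on
    a chord by [discrete_ivt]; any other is within [2 * rho] of an extreme one, since a vertex is
    near. *)
Lemma chords_cover (R : realType) (g : curve R) (s : seq R) (a b rho : R) :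
    `|a| <= 1 -> `|b| <= 1 ->
    (forall x, curve_lo g <= x <= curve_hi g -> exists v, [/\ v \in curve_lo g :: s,
       `|(g x).1 - (g v).1| <= rho & `|(g x).2 - (g v).2| <= rho]) ->
  exists m M : R, forall x, curve_lo g <= x <= curve_hi g ->
    let t := functional a b (centred (g x)) in
    [\/ `|t - m| <= rho *+ 2, `|t - M| <= rho *+ 2 |
     exists e tau, [/\ e \in chords g s, 0 <= tau <= 1 &
       t = a * (e.1.1 + tau * (e.2.1 - e.1.1)) + b * (e.1.2 + tau * (e.2.2 - e.1.2))]].
Proof.
move=> a1 b1 approx; pose w k := functional a b (vertex g s k); set n := size s.
have [kM kMn wM] := finite_argmax w n.
have [km kmn wm] := finite_argmax (fun k => - w k) n.
exists (w km), (w kM) => x xI /=; set t := functional a b (centred (g x)).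
have [k kn tk] : exists2 k, (k <= n)%N & `|t - w k| <= rho *+ 2.
  have [v [vs v1 v2]] := approx x xI.
  exists (index v (curve_lo g :: s)); first by move: vs; rewrite -index_mem.
  by rewrite /w /vertex nth_index //; exact: functional_dist.
have wkM := wM k kn; have wkm := wm k kn; rewrite lerN2 in wkm.
move: tk; rewrite ler_distl => /andP[tk1 tk2].
have [Mt|tM] := leP (w kM) t.
  by apply: Or32; rewrite ler_distl; move: Mt wkM tk1 tk2; clear; lra.
have [tm|mt] := leP t (w km).
  by apply: Or31; rewrite ler_distl; move: tm wkm tk1 tk2; clear; lra.
have [j jn /between_convex[tau t01 te]] := discrete_ivt kmn kMn mt tM.
apply: Or33; exists (vertex g s j, vertex g s j.+1), tau; split=> //.
  by apply/mapP; exists j => //; rewrite mem_iota.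
by rewrite te /w /functional /=; ring.
Qed.

Lemma polygonal_le_curve_length (R : realType) (g : curve R) (s : seq R) :
  itv_partition (curve_lo g) (curve_hi g) s ->
  ((polygonal_length (curve_lo g) g s)%:E <= curve_length g)%E.
Proof. by move=> sP; apply: ereal_sup_ubound; exists s. Qed.

Lemma curve_length_ge0 (R : realType) (g : curve R) : (0 <= curve_length g)%E.
Proof.
have [s [sP _]] := @curve_partition R g 1 ltr01.
apply: le_trans (polygonal_le_curve_length sP); rewrite lee_fin.
by apply: sumr_ge0 => k _; exact: edist_ge0.
Qed.

Lemma edist_le_curve_length (R : realType) (g : curve R) (x : R) :
  curve_lo g <= x <= curve_hi g ->
  ((edist (g x) (g (curve_lo g)))%:E <= curve_length g)%E.
Proof.
case/andP; rewrite le_eqVlt => /predU1P[<- _|lox].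
  rewrite [edist _ _](_ : _ = 0) ?curve_length_ge0 //.
  by rewrite /edist !subrr expr0n /= addr0 sqrtr0.
rewrite le_eqVlt => /predU1P[xhi|xhi].
  have := @polygonal_le_curve_length R g [:: x]; rewrite -xhi.
  move=> /(_ (itv_partition1 lox)); rewrite /polygonal_length /=.
  by rewrite big_nat1.
have part : itv_partition (curve_lo g) (curve_hi g) [:: x; curve_hi g].
  by split; rewrite /= ?lox ?xhi.
apply: le_trans (polygonal_le_curve_length part).
by rewrite lee_fin /polygonal_length /= 2?big_nat_recr //= big_geq // add0r lerDl edist_ge0.
Qed.

Lemma pmap_uniq_inj (T U : eqType) (f : T -> option U) (s : seq T) :
  (forall u v x, f u = Some x -> f v = Some x -> u = v) -> uniq s -> uniq (pmap f s).
Proof.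
move=> finj; elim: s => //= u s IH /andP[us /IH uniqs].
case fu: (f u) => [x|] //=; rewrite uniqs andbT mem_pmap; apply/mapP => -[v vs /esym fv].
by rewrite (finj _ _ _ fu fv) vs in us.
Qed.

Lemma mixed_cover_length (R : realType) (J : finType) (I : countType)
    (c r : J -> R) (c' r' : I -> R) (a b S : R) :
    (forall j, 0 <= r j) -> (forall i, 0 <= r' i) ->
    (forall t, a <= t <= b ->
       (exists j, `|t - c j| <= r j) \/ exists i, `|t - c' i| <= r' i) ->
    (forall s : seq I, uniq s -> \sum_(i <- s) r' i *+ 2 <= S) ->
  b - a <= \sum_j r j *+ 2 + S.
Proof.
move=> r0 r'0 cov bound.
pose cc (u : J + I) := match u with inl j => c j | inr i => c' i end.
pose rr (u : J + I) := match u with inl j => r j | inr i => r' i end.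
apply: (@interval_cover_length R (J + I)%type cc rr).
- by case.
- by move=> t /cov[[j tj]|[i ti]]; [exists (inl j)|exists (inr i)].
move=> s us.
pose left (u : J + I) := if u is inl j then Some j else None.
pose right (u : J + I) := if u is inr i then Some i else None.
have -> : \sum_(u <- s) rr u *+ 2 =
    \sum_(j <- pmap left s) r j *+ 2 + \sum_(i <- pmap right s) r' i *+ 2.
  elim: (s) => [|[j|i] t IH]; first by rewrite !big_nil addr0.
    by rewrite /= !big_cons IH addrA.
  by rewrite /= !big_cons IH addrCA.
apply: lerD; last first.
  by apply: bound; apply: pmap_uniq_inj us => -[j|i] [j'|i'] // x [->] [->].
have ul : uniq (pmap left s) by apply: pmap_uniq_inj us => -[j|i] [j'|i'] // x [->] [->].
rewrite big_uniq //= [leLHS]big_mkcond; apply: ler_sum => j _.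
by case: ifP => // _; rewrite mulrn_wge0.
Qed.

Lemma barrier_meets (R : realType) (Gamma : set (R * R)) (a b t : R) :
    barrier (square 0 1) Gamma -> - ((`|a| + `|b|) / 2) <= t <= (`|a| + `|b|) / 2 ->
    0 < `|a| + `|b| ->
  exists2 p, Gamma p & functional a b (centred p) = t.
Proof.
move=> bar tI ab0.
pose l := t / (`|a| + `|b|).
(* From the centre, move by [l] along the signs of [a] and [b]: the functional takes the value
   [l * (|a| + |b|) = t], and [|l| <= 1/2] keeps [p] in the square. *)
pose p : R * R := (1 / 2 + l * Num.sg a, 1 / 2 + l * Num.sg b).
pose L : set (R * R) := [set q | a * q.1 + b * q.2 = t + (a + b) / 2].
have ab : (a != 0) || (b != 0).
  apply: contraTT ab0; rewrite negb_or !negbK => /andP[/eqP -> /eqP ->].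
  by rewrite !normr0 addr0 ltxx.
have l2 : `|l| <= 1 / 2.
  rewrite /l ler_norml ler_pdivlMr // ler_pdivrMr //.
  by move: tI; clear; lra.
have sgI (x : R) : 0 <= 1 / 2 + l * Num.sg x <= 1.
  have : `|l * Num.sg x| <= 1 / 2.
    rewrite normrM; apply: le_trans l2; rewrite -[leRHS]mulr1 ler_wpM2l //.
    by rewrite normr_sg lern1; case: (x == 0).
  by rewrite ler_norml; clear; lra.
have [] := bar L.
- by exists a, b, (t + (a + b) / 2).
- exists p; split; last by split; rewrite /= in_itv /=; exact: sgI.
  have tl : t = l * (`|a| + `|b|) by rewrite /l divfK // gt_eqF.
  rewrite /L /p /= [in RHS]tl !normrEsg; ring.
- move=> q [Lq Gq]; exists q => //.
  by move: Lq; rewrite /L /functional /centred /=; lra.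
Qed.

(** Chords of finitely many curves suffice: the chords are no longer than their curves, their
    vertices lie on [Gamma], and what they fail to cover in a projection fits into intervals of
    total length at most [z]. *)
Lemma barrier_segments (R : realType) (I : countType) (gamma : I -> curve R)
    (Gamma : set (R * R)) (z : R) : 0 < z ->
    rectifiable_union gamma Gamma -> barrier (square 0 1) Gamma ->
    Gamma `<=` square (- (1 / 2)) (3 / 2) ->
  exists E : seq ((R * R) * (R * R)), [/\
    forall e, e \in E -> [/\ `|e.1.1| <= 1, `|e.1.2| <= 1, `|e.2.1| <= 1 & `|e.2.2| <= 1],
    ((\sum_(e <- E) edist e.2 e.1)%:E <= total_length gamma)%E &
    segment_cover E z].
Proof.
move=> z0 [GE lenfin totfin] bar GU.
pose L i := fine (curve_length (gamma i)).
have LE i : curve_length (gamma i) = (L i)%:E.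
  by rewrite /L fineK // fin_real // lenfin (lt_le_trans _ (curve_length_ge0 _)) // ltNy0.
have L0 i : 0 <= L i by rewrite -lee_fin -LE curve_length_ge0.
have tot0 : (0 <= total_length gamma)%E by apply: esum_ge0 => i _; exact: curve_length_ge0.
have totF : total_length gamma \is a fin_num by rewrite ge0_fin_numE.
have sub (G : seq I) : uniq G -> ((\sum_(i <- G) L i)%:E <= total_length gamma)%E.
  move=> uG; apply: esum_ge; exists [set` G]; first by split=> //; exact: finite_seq.
  rewrite -fsbig_seq // -sumEFin le_eqVlt; apply/orP; left; apply/eqP.
  by apply: eq_bigr => i _.
(* The curves outside F are covered by balls of radius twice their length, those
   in F by their chords and two balls at the extreme values. *)
pose d := z / 16.
have d0 : 0 < d by rewrite divr_gt0.
have [_ [A [Afin _] <-]] := ub_ereal_sup_adherent d0 totF.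
set F := finite_support _ _ _ => headF0.
have headF : (total_length gamma - d%:E < \sum_(i <- F) curve_length (gamma i))%E := headF0.
have uF : uniq F by exact: finite_support_uniq.
have tail (G : seq I) : uniq G -> (forall i, i \in G -> i \notin F) -> \sum_(i <- G) L i <= d.
  move=> uG GF; have := sub (F ++ G); rewrite cat_uniq uF uG andbT /=.
  have -> : ~~ has (mem F) G by apply/hasPn.
  move=> /(_ isT); rewrite big_cat /= -(fineK totF) lee_fin.
  move: headF; rewrite (eq_bigr (fun i => (L i)%:E)) => [|i _]; last exact: LE.
  rewrite sumEFin -(fineK totF) -EFinB lte_fin.
  by clear; lra.
(* Each curve of [F] needs two intervals of length [4 * rho], in all less than [z / 8]; the summand
   64 keeps the denominator positive when [F] is empty. *)
pose rho := z / (64 * (size F)%:R + 64).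
have den0 : 0 < 64 * (size F)%:R + 64 :> R by have := ler0n R (size F); clear; lra.
have rho0 : 0 < rho by rewrite divr_gt0.
have /choice[s sP] := fun i => curve_partition (gamma i) rho0.
pose E := flatten [seq chords (gamma i) (s i) | i <- F].
exists E; split.
- have inU i v : v \in curve_lo (gamma i) :: s i ->
      `|(centred (gamma i v)).1| <= 1 /\ `|(centred (gamma i v)).2| <= 1.
    move=> vs; have [sp _] := sP i.
    have vI : curve_lo (gamma i) <= v <= curve_hi (gamma i).
      have vlt : (index v (curve_lo (gamma i) :: s i) < (size (s i)).+1)%N.
        by rewrite -/(size (curve_lo (gamma i) :: s i)) index_mem.
      rewrite -(nth_index (curve_hi (gamma i)) vs).
      by rewrite (itv_partition_nth_ge vlt sp) (itv_partition_nth_le vlt sp).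
    have : Gamma (gamma i v) by rewrite GE; exists i => //; exists v => //; rewrite /= in_itv.
    move=> /GU[]; rewrite /= !in_itv /= !ler_norml; clear; lra.
  move=> e /flattenP[_ /mapP[i iF ->] /mapP[k]]; rewrite mem_iota /= add0n => ks ->.
  have [|h1 h2] := inU i (nth (curve_lo (gamma i)) (curve_lo (gamma i) :: s i) k).
    by apply: mem_nth; rewrite /= ltnS ltnW.
  have [|h3 h4] := inU i (nth (curve_lo (gamma i)) (curve_lo (gamma i) :: s i) k.+1).
    by apply: mem_nth; rewrite /= ltnS.
  by [].
- apply: le_trans (sub F uF); rewrite lee_fin /E big_flatten big_map /=.
  apply: ler_sum => i _; rewrite sum_chords -lee_fin -LE.
  by apply: polygonal_le_curve_length; case: (sP i).
move=> a b a1 b1 J c r r0 cr.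
have [ab0|ab0] := leP (`|a| + `|b|) 0.
  apply: le_trans ab0 _; rewrite addr_ge0 ?(ltW z0) //; apply: sumr_ge0 => j _.
  by rewrite mulrn_wge0.
have /choice[mM mMP] : forall i, exists mM : R * R, forall x,
    curve_lo (gamma i) <= x <= curve_hi (gamma i) ->
    let t := functional a b (centred (gamma i x)) in
    [\/ `|t - mM.1| <= rho *+ 2, `|t - mM.2| <= rho *+ 2 |
     exists e tau, [/\ e \in chords (gamma i) (s i), 0 <= tau <= 1 &
       t = a * (e.1.1 + tau * (e.2.1 - e.1.1)) + b * (e.1.2 + tau * (e.2.2 - e.1.2))]].
  move=> i; have [m [M h]] := chords_cover a1 b1 (sP i).2.
  by exists (m, M).
pose J' : finType := (J + 'I_(size F) * bool)%type.
pose cJ (u : J') := match u with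
  | inl j => c j
  | inr (k, e) => let q := mM (tnth (in_tuple F) k) in if e then q.1 else q.2
  end.
pose rJ (u : J') := match u with inl j => r j | inr _ => rho *+ 2 end.
pose cI i := functional a b (centred (gamma i (curve_lo (gamma i)))).
pose rI i := if i \in F then 0 else L i *+ 2.
have := @mixed_cover_length R J' I cJ rJ cI rI
  (- ((`|a| + `|b|) / 2)) ((`|a| + `|b|) / 2) (z / 2).
move=> /(_ _ _ _ _)/wrap[].
- by case=> [j|_] //=; rewrite mulrn_wge0 // ltW.
- by move=> i; rewrite /rI; case: ifP => // _; rewrite mulrn_wge0.
- move=> t tI; have [p] := barrier_meets bar tI ab0.
  rewrite GE => -[i _ [x]]; rewrite /= in_itv /= => xI <- tE.
  have [iF|iF] := boolP (i \in F); last first.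
    right; exists i; rewrite /rI (negbTE iF) -tE /cI.
    have := edist_le_curve_length xI; rewrite LE lee_fin => dL.
    have [h1 h2] := coord_edist (gamma i x) (gamma i (curve_lo (gamma i))).
    by apply: functional_dist => //; [exact: le_trans h1 dL|exact: le_trans h2 dL].
  left; have /tnthP[k ik] : i \in in_tuple F by [].
  have [tm|tM|[e [tau [eE tau01 te]]]] := mMP i x xI.
  + by exists (inr (k, true)); rewrite /= -ik -tE.
  + by exists (inr (k, false)); rewrite /= -ik -tE.
  + have [|j tj] := cr e tau _ tau01; last by exists (inl j); rewrite /= -tE te.
    by apply/flattenP; exists (chords (gamma i) (s i)) => //; exact: map_f.
- move=> G uG.
  (* An interval of radius [2 * L i] has length [4 * L i], so the tail costs at most
     [4 * d = z / 4]. *)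
  have -> : \sum_(i <- G) rI i *+ 2 = 4 * \sum_(i <- [seq i <- G | i \notin F]) L i.
    rewrite big_filter mulr_sumr [RHS]big_mkcond /=; apply: eq_bigr => i _.
    by rewrite /rI; case: (i \in F) => /=; [rewrite mul0rn|ring].
  have : \sum_(i <- [seq i <- G | i \notin F]) L i <= d.
    apply: tail; first exact: filter_uniq.
    by move=> i; rewrite mem_filter => /andP[].
  by rewrite /d; move: z0; clear; lra.
rewrite big_sumType /= sumr_const card_prod card_ord card_bool.
have rhoF : rho *+ 2 *+ 2 *+ (size F * 2) <= z / 4.
  have -> : rho *+ 2 *+ 2 *+ (size F * 2) = rho * (8 * (size F)%:R).
    by rewrite -[LHS]mulr_natr natrM; ring.
  rewrite /rho mulrAC ler_pdivrMr //; move: z0; have := ler0n R (size F).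
  by clear; move: (size F)%:R => n *; nra.
by move: rhoF z0; clear; lra.
Qed.

Unset Implicit Arguments.
Set Strict Implicit.

Theorem theorem1 (R : realType) (I : countType) (gamma : I -> curve R)
    (Gamma : set (R * R)) :
  rectifiable_union gamma Gamma ->
  barrier (square 0 1) Gamma ->
  Gamma `<=` square (- (1 / 2)) (3 / 2) ->
  ((2 + 10 ^- 12)%:E <= total_length gamma)%E.
Proof.
move=> rect bar GU; rewrite leNgt; apply/negP => short.
pose eps : R := 10 ^- 12.
have eps0 : 0 < eps by rewrite invr_gt0 exprn_gt0.
have eps1 : eps <= (1 / 1000) ^+ 4.
  by rewrite /eps (_ : 10 ^+ 12 = 1000 ^+ 4 :> R) -?exprVn ?div1r //; ring.
(* The tolerance [eps / 10] is the one that [no_short_segments] admits. *)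
have [E [EU Etot Ecov]] := barrier_segments (divr_gt0 eps0 (ltr0n _ 10)) rect bar GU.
have := @no_short_segments R E (fun e => edist e.2 e.1) eps (ltW eps0) eps1 EU.
move=> /(_ _ Ecov)/wrap[]; first by move=> e; rewrite edist_ge0 edist_sqr.
by apply/negP; rewrite -leNgt -lee_fin; apply: le_trans Etot (ltW short).
Qed.
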